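(* Let $k\ge2$ and $H\sim\mathcal{H}(n,p,k)$. Assume $\xi\le\frac{n^{1/4}}{\log n}$. There is a polynomial-time algorithm certifying that $\chi(H)>\xi$ with high probability when $\bar m\ge O_k\!\left(\xi^{2k}n^{k/2}\log^3n\right)$.
   Context: $\mathcal{H}(n,p,k)$ is the distribution over $k$-uniform hypergraphs on vertex set $[n]$ in which each of the $\binom nk$ possible hyperedges is included independently with probability $p$; $\bar m=p\binom nk$. A $q$-coloring of $H$ is a map $f:[n]\to[q]$ such that each $f^{-1}(i)$ contains no hyperedge; $\chi(H)$ is the least $q$ for which a $q$-coloring exists. ''$\bar m\ge O_k(g)$'' means $\bar m\ge C_kg$ for a certain constant $C_k$ depending only on $k$. ''With high probability'': probability $1-o(1)$ as $n\to\infty$. A certifying algorithm outputs the bound or ''fail'', never outputs the bound when false, and fails with probability $o(1)$. *)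

(* Defs.v *)
From HB Require Import structures.
From mathcomp Require Import all_boot all_order all_algebra.
From mathcomp Require Import all_classical all_reals all_analysis.
Import Order.TTheory GRing.Theory Num.Theory.

Set Implicit Arguments.
Unset Strict Implicit.
Unset Printing Implicit Defensive.

Local Open Scope nat_scope.

(** * Uniform hypergraphs *)

Definition hyperedge (n k : nat) := {e : {set 'I_n} | #|e| == k}.

Definition hypergraph (n k : nat) := {set hyperedge n k}.

Definition colorable (n k : nat) (H : hypergraph n k) (q : nat) : bool :=
  [exists f : {ffun 'I_n -> 'I_q},
    [forall i : 'I_q, [forall e in H, ~~ (val e \subset f @^-1: [set i])]]].

(** For [1 < k], coloring all vertices differently is proper, so that it is
    enough to search among [q <= n]; see [chromatic_numberP].  For [k < 2] there
    may be no proper coloring at all, and the value is then meaningless. *)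
Definition chromatic_number (n k : nat) (H : hypergraph n k) : nat :=
  find (colorable H) (iota 0 n.+1).

Lemma card_hyperedge (n k : nat) : #|{: hyperedge n k}| = 'C(n, k).
Proof.
rewrite card_sub -[in RHS](card_ord n) -card_draws.
by apply: eq_card => e; rewrite !inE.
Qed.

Lemma colorable_order (n k : nat) (H : hypergraph n k) :
  1 < k -> colorable H n.
Proof.
move=> k_gt1; apply/existsP; exists [ffun v => v].
apply/forallP => i; apply/forall_inP => e _; apply/negP => sub.
have := subset_leq_card sub; rewrite (eqP (valP e)).
have -> : [ffun v => v] @^-1: [set i] = [set i].
  by apply/setP => v; rewrite !inE ffunE.
by rewrite cards1 leqNgt k_gt1.
Qed.

Lemma chromatic_numberP (n k : nat) (H : hypergraph n k) : 1 < k ->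
  colorable H (chromatic_number H) /\
  forall q, colorable H q -> chromatic_number H <= q.
Proof.
move=> k_gt1; have has_c : has (colorable H) (iota 0 n.+1).
  apply/hasP; exists n; last exact: colorable_order.
  by rewrite mem_iota leq0n add0n ltnSn.
have lt_chi : chromatic_number H < n.+1.
  by move: has_c; rewrite has_find size_iota.
split=> [|q cq].
  by move: (nth_find 0 has_c); rewrite nth_iota.
rewrite leqNgt; apply/negP => lt_q.
move: (before_find 0 lt_q); rewrite nth_iota ?cq //.
exact: ltn_trans lt_q lt_chi.
Qed.

(** * The random hypergraph H(n, p, k) *)

Section RandomHypergraph.
Local Open Scope ring_scope.
Variable R : realType.

Definition hypergraph_pmf (n k : nat) (p : R) (H : hypergraph n k) : R :=
  \prod_(e : hyperedge n k) (if e \in H then p else 1 - p).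

Definition hypergraph_prob (n k : nat) (p : R) (E : pred (hypergraph n k)) : R :=
  \sum_(H : hypergraph n k | E H) hypergraph_pmf p H.

Lemma hypergraph_prob_total (n k : nat) (p : R) :
  hypergraph_prob p (xpredT : pred (hypergraph n k)) = 1.
Proof.
rewrite /hypergraph_prob /hypergraph_pmf.
transitivity (\prod_(e : hyperedge n k) (p + (1 - p))); last first.
  by apply: big1 => e _; rewrite addrC subrK.
by rewrite bigA_distr /=; apply: eq_bigr => H _.
Qed.

End RandomHypergraph.

(** * Polynomial-time algorithms

    The model is a random access machine in the style of Cook and Reckhow, with
    structured control flow: finitely many registers occur in a program, and
    memory is addressed indirectly through registers.  Every instruction has
    unit cost.  Since addition and truncated subtraction are the only
    arithmetic, an execution of [T] steps enlarges the bit length of the stored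
    numbers by at most [T] plus a constant depending on the program, so that
    polynomial time here agrees with polynomial time on Turing machines. *)

Inductive program :=
| Skip
| Const of nat & nat         (* r_x := c         *)
| Plus of nat & nat & nat    (* r_x := r_y + r_z *)
| Minus of nat & nat & nat   (* r_x := r_y - r_z *)
| Read of nat & nat          (* r_x := M[r_y]    *)
| Write of nat & nat         (* M[r_x] := r_y    *)
| Seq of program & program
| IfNZ of nat & program & program
| WhileNZ of nat & program.

Record state := State { regs : nat -> nat; memory : nat -> nat }.

Definition upd (f : nat -> nat) (x v : nat) : nat -> nat :=
  fun y => if y == x then v else f y.

Definition set_reg (s : state) (x v : nat) := State (upd (regs s) x v) (memory s).

Definition set_mem (s : state) (a v : nat) := State (regs s) (upd (memory s) a v).

(** [exec P s s' T]: started in [s], the program [P] halts in [s'] after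
    exactly [T] steps. *)
Inductive exec : program -> state -> state -> nat -> Prop :=
| exec_skip s :
    exec Skip s s 1
| exec_const s x c :
    exec (Const x c) s (set_reg s x c) 1
| exec_add s x y z :
    exec (Plus x y z) s (set_reg s x (regs s y + regs s z)) 1
| exec_sub s x y z :
    exec (Minus x y z) s (set_reg s x (regs s y - regs s z)) 1
| exec_read s x y :
    exec (Read x y) s (set_reg s x (memory s (regs s y))) 1
| exec_write s x y :
    exec (Write x y) s (set_mem s (regs s x) (regs s y)) 1
| exec_seq P Q s s' s'' T T' :
    exec P s s' T -> exec Q s' s'' T' -> exec (Seq P Q) s s'' (T + T')
| exec_if_nz x P Q s s' T :
    regs s x != 0 -> exec P s s' T -> exec (IfNZ x P Q) s s' T.+1
| exec_if_z x P Q s s' T :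
    regs s x = 0 -> exec Q s s' T -> exec (IfNZ x P Q) s s' T.+1
| exec_while_nz x P s s' s'' T T' :
    regs s x != 0 -> exec P s s' T -> exec (WhileNZ x P) s' s'' T' ->
    exec (WhileNZ x P) s s'' (T + T').+1
| exec_while_z x P s :
    regs s x = 0 -> exec (WhileNZ x P) s s 1.

Lemma exec_det P s s1 s2 T1 T2 :
  exec P s s1 T1 -> exec P s s2 T2 -> s1 = s2 /\ T1 = T2.
Proof.
move=> e1; elim: e1 s2 T2 => {P s s1 T1}.
- by move=> s s2 T2 e2; inversion e2.
- by move=> s x c s2 T2 e2; inversion e2.
- by move=> s x y z s2 T2 e2; inversion e2.
- by move=> s x y z s2 T2 e2; inversion e2.
- by move=> s x y s2 T2 e2; inversion e2.
- by move=> s x y s2 T2 e2; inversion e2.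
- move=> P Q s s' s'' T T' _ IHP _ IHQ s2 T2 e2; inversion e2 as
    [| | | | | | ? ? ? ? ? ? ? eP eQ | | | |]; subst.
  have [? ?] := IHP _ _ eP; subst.
  by have [-> ->] := IHQ _ _ eQ.
- move=> x P Q s s' T nz _ IH s2 T2 e2; inversion e2 as
    [| | | | | | | ? ? ? ? ? ? _ eP | ? ? ? ? ? ? z _ | |]; subst.
    by have [-> ->] := IH _ _ eP.
  by rewrite z in nz.
- move=> x P Q s s' T z _ IH s2 T2 e2; inversion e2 as
    [| | | | | | | ? ? ? ? ? ? nz _ | ? ? ? ? ? ? _ eQ | |]; subst.
    by rewrite z in nz.
  by have [-> ->] := IH _ _ eQ.
- move=> x P s s' s'' T T' nz _ IHP _ IHQ s2 T2 e2; inversion e2 as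
    [| | | | | | | | | ? ? ? ? ? ? ? _ eP eW | ? ? ? z]; subst.
    have [? ?] := IHP _ _ eP; subst.
    by have [-> ->] := IHQ _ _ eW.
  by rewrite z in nz.
- move=> x P s z s2 T2 e2; inversion e2 as
    [| | | | | | | | | ? ? ? ? ? ? ? nz _ _ | ? ? ? _]; subst => //.
  by rewrite z in nz.
Qed.

(** The input occupies the memory cells [0, ..., size w - 1]; everything else
    is initially zero. *)
Definition initial_state (w : seq nat) := State (fun=> 0) (fun a => nth 0 w a).

Definition bit_length (a : nat) := (trunc_log 2 a).+1.

Definition input_length (w : seq nat) := \sum_(a <- w) bit_length a.

(** A Boolean answer is read off register 0: nonzero means [true]. *)
Definition polytime (I : Type) (enc : I -> seq nat) (f : I -> bool) : Prop :=
  exists (P : program) (c d : nat), forall x : I,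
    exists (s : state) (T : nat),
      [/\ exec P (initial_state (enc x)) s T,
          T <= c * input_length (enc x) ^ d + c
        & f x = (regs s 0 != 0)].

(** * Certifying lower bounds on the chromatic number *)

(** [inst_bound] is the bound [t] to be certified, in the form "the chromatic
    number exceeds [t]".  A real bound [xi] is passed as [Num.truncn xi], which
    loses nothing since the chromatic number is a natural number. *)
Record instance (k : nat) := Instance {
  inst_order : nat;
  inst_graph : hypergraph inst_order k;
  inst_bound : nat }.

Arguments Instance {k inst_order} inst_graph inst_bound.

(** Cell [j] of the adjacency table, for [j < n ^ k], corresponds to the
    [k]-tuple of vertices whose entries are the [k] base-[n] digits of [j]. *)
Definition digit_set (n k j : nat) : {set 'I_n} :=
  [set v : 'I_n | [exists i : 'I_k, (v : nat) == (j %/ n ^ i) %% n]].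

Definition adjacency_table (n k : nat) (H : hypergraph n k) : seq nat :=
  [seq nat_of_bool (digit_set n k j \in [set val e | e in H])
     | j <- iota 0 (n ^ k)].

Definition encode (k : nat) (x : instance k) : seq nat :=
  [:: inst_order x, inst_bound x & adjacency_table (inst_graph x)].

(* Main.v *)
Require Import Defs.
From HB Require Import structures.
From mathcomp Require Import all_boot all_order all_algebra.
From mathcomp Require Import all_classical all_reals all_analysis.
From mathcomp Require Import zify ring lra.
Import Order.TTheory GRing.Theory Num.Theory.
Import numFieldNormedType.Exports.

Set Implicit Arguments.
Unset Strict Implicit.
Unset Printing Implicit Defensive.

(** A coloring with [t] colors leaves a class containing an independent set [S]
    of any size [s] with [(s - 1) t < n].  Fix a guess [j / n^k] for [p] and give
    a [k]-set the weight [n^k - j] if it is a hyperedge and [-j] otherwise,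
    placed on the single [k]-tuple [(i, a, b)] that lists the set increasingly;
    here [i] is a vertex and [a], [b] are tuples of lengths [al], [be], which
    differ by at most 1 and satisfy [1 + al + be = k].  Only negative weights
    occur inside [S], so the weight [w] has [S]-sum [- j C(s, k)].  By
    Cauchy-Schwarz in [i] the square of this sum is at most [s] times the value
    of a quadratic form on the indicator of [S^(k-1)], with matrix
      [M (a, b') (a', b) = sum_i w(i, a, b) w(i, a', b')],
    and repeated Cauchy-Schwarz bounds the form by [s^(k-1) tr(M^L)^(1/L)] for
    [L] a power of 2.  The certificate is thus an inequality between integers
      [tr(M^L) (k!^2 s^k)^L < (j (s - k)^k)^(2 L)],
    searched for over all [j], [s] and all [L <= n].

    For the random hypergraph, expand [E tr(M^L)] along walks.  Exploring a walk,
    charge [x] to a hyperedge seen for the first time and [y] to a repetition,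
    with [x y = 2 p n^(2k)] and [x n^(k/2) = y]: the product of the charges
    dominates the expectation of the product of the weights, and because [M] pairs
    two hyperedges through [i] and splits them evenly into rows and columns, each
    step costs at most [(2 L + 2)^2 y^2].  Markov's inequality with
    [log n <= L = O(log n)] concludes. *)

(** * Compiling bounded loops to the random access machine *)

Local Open Scope nat_scope.

Inductive expr :=
| EVar of nat
| ECst of nat
| EAdd of expr & expr
| ESub of expr & expr
| EMul of expr & expr
| EIn of expr
| EArr of expr
| ESum of nat & expr & expr
| EIter of nat & expr & expr & expr & expr.

(** Loop bounds, array sizes and first factors are clipped to [B]; hence the cost
    of an evaluation is polynomial in [B] whatever the values computed.  The array
    built by [EIter] holds 0 beyond [B], and only the innermost array is
    accessible. *)
Fixpoint ev (w : seq nat) (B : nat) (e : expr) (rho A : nat -> nat) : nat :=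
  match e with
  | EVar x => rho x
  | ECst c => c
  | EAdd a b => ev w B a rho A + ev w B b rho A
  | ESub a b => ev w B a rho A - ev w B b rho A
  | EMul a b => minn (ev w B a rho A) B * ev w B b rho A
  | EIn a => nth 0 w (ev w B a rho A)
  | EArr a => A (ev w B a rho A)
  | ESum x a b => \sum_(v < minn (ev w B a rho A) B) ev w B b (upd rho x v) A
  | EIter x cnt ini stp idx =>
      iter (minn (ev w B cnt rho A) B)
        (fun A' r => if r < B then ev w B stp (upd rho x r) A' else 0)
        (fun r => if r < B then ev w B ini (upd rho x r) A else 0)
        (ev w B idx rho A)
  end.

(** Temporaries are the odd registers.  The memory is divided into regions of
    length [B]: the input occupies region 0, [cur] is the region of the accessible
    array, and all regions from [fr] on are free. *)
Definition tmp (i : nat) := i.*2.+1.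
Definition fuel := 0.
Definition one := 2.
Definition zero := 4.
Definition var (x : nat) := x.*2 + 6.

Definition mov (x y : nat) := Plus x y zero.
(** Truncated subtraction yields the minimum with [B], as [min x B = x - (x - B)]. *)
Definition clip (x o : nat) := Seq (Minus o x fuel) (Minus x x o).
Definition loop (x : nat) (P : program) := WhileNZ x (Seq (Minus x x one) P).

(** Region [m] starts at address [B * m]. The machine cannot multiply, but [m] is fixed at compile
    time, so [m] unrolled additions reach it. *)
Fixpoint shift (x m : nat) :=
  if m is m'.+1 then Seq (Plus x x fuel) (shift x m') else Skip.

Definition fetch (d m : nat) :=
  Seq (Minus (tmp d.+1) fuel (tmp d))
    (IfNZ (tmp d.+1) (Seq (shift (tmp d) m) (Read (tmp d) (tmp d)))
       (Const (tmp d) 0)).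

Definition tabulate (d x m : nat) (P : program) :=
  Seq (mov (tmp d) fuel)
    (loop (tmp d)
      (Seq (mov (var x) (tmp d))
      (Seq P
      (Seq (mov (tmp d.+2) (tmp d))
      (Seq (shift (tmp d.+2) m)
        (Write (tmp d.+2) (tmp d.+1))))))).

(** The result goes to [tmp d]; the temporaries below it hold pending values of enclosing
    expressions, so they act as a stack. Loops restore [var x] at their end. An iteration keeps its
    current array in region [fr.+1]: the next array is built in region [fr], because each cell may
    read the whole old array, and is then copied back. *)
Fixpoint comp (e : expr) (d cur fr : nat) : program :=
  match e with
  | EVar x => mov (tmp d) (var x)
  | ECst c => Const (tmp d) c
  | EAdd a b =>
      Seq (comp a d cur fr)
        (Seq (comp b d.+1 cur fr) (Plus (tmp d) (tmp d) (tmp d.+1)))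
  | ESub a b =>
      Seq (comp a d cur fr)
        (Seq (comp b d.+1 cur fr) (Minus (tmp d) (tmp d) (tmp d.+1)))
  | EMul a b =>
      Seq (comp a d cur fr)
      (Seq (clip (tmp d) (tmp d.+1))
      (Seq (comp b d.+1 cur fr)
      (Seq (Const (tmp d.+2) 0)
      (Seq (loop (tmp d) (Plus (tmp d.+2) (tmp d.+2) (tmp d.+1)))
        (mov (tmp d) (tmp d.+2))))))
  | EIn a => Seq (comp a d cur fr) (fetch d 0)
  | EArr a => Seq (comp a d cur fr) (fetch d cur)
  | ESum x a b =>
      Seq (comp a d cur fr)
      (Seq (clip (tmp d) (tmp d.+1))
      (Seq (mov (tmp d.+1) (var x))
      (Seq (Const (tmp d.+2) 0)
      (Seq (loop (tmp d)
             (Seq (mov (var x) (tmp d))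
             (Seq (comp b d.+3 cur fr)
               (Plus (tmp d.+2) (tmp d.+2) (tmp d.+3)))))
      (Seq (mov (var x) (tmp d.+1))
        (mov (tmp d) (tmp d.+2)))))))
  | EIter x cnt ini stp idx =>
      Seq (comp idx d cur fr)
      (Seq (comp cnt d.+1 cur fr)
      (Seq (clip (tmp d.+1) (tmp d.+2))
      (Seq (mov (tmp d.+2) (var x))
      (Seq (tabulate d.+3 x fr.+1 (comp ini d.+4 cur fr.+2))
      (Seq (loop (tmp d.+1)
             (Seq (tabulate d.+3 x fr (comp stp d.+4 fr.+1 fr.+2))
               (tabulate d.+3 x fr.+1
                  (Seq (mov (tmp d.+4) (tmp d.+3)) (fetch d.+4 fr)))))
      (Seq (mov (var x) (tmp d.+2))
        (fetch d fr.+1)))))))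
  end.

(** A total correctness triple with a cost bound. The start state is fixed and the triple of the
    second program sits in the postcondition of the first, so that proofs execute a program
    symbolically. *)
Definition runs (P : program) (s : state) (c : nat) (Q : state -> Prop) :=
  exists s' T, [/\ exec P s s' T, T <= c & Q s'].

Lemma runs_le P s c c' Q : runs P s c Q -> c <= c' -> runs P s c' Q.
Proof.
by move=> [s' [T [e l q]]] cc; exists s', T; split=> //; exact: leq_trans cc.
Qed.

Lemma runs_imp P s c (Q Q' : state -> Prop) :
  runs P s c Q -> (forall s', Q s' -> Q' s') -> runs P s c Q'.
Proof. by move=> [s' [T [e l q]]] i; exists s', T; split=> //; exact: i. Qed.

Lemma runs_seq P P' s c c' Q :
  runs P s c (fun s' => runs P' s' c' Q) -> runs (Seq P P') s (c + c') Q.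
Proof.
move=> [s' [T [e l [s'' [T' [e' l' q]]]]]]; exists s'', (T + T'); split=> //.
  exact: exec_seq e e'.
exact: leq_add.
Qed.

Lemma runs_skip s (Q : state -> Prop) : Q s -> runs Skip s 1 Q.
Proof. by move=> q; exists s, 1; split=> //; constructor. Qed.

Lemma runs_const s x c (Q : state -> Prop) :
  Q (set_reg s x c) -> runs (Const x c) s 1 Q.
Proof. by move=> q; exists (set_reg s x c), 1; split=> //; constructor. Qed.

Lemma runs_plus s x y z (Q : state -> Prop) :
  Q (set_reg s x (regs s y + regs s z)) -> runs (Plus x y z) s 1 Q.
Proof. by move=> q; eexists _, 1; split; [constructor| |exact: q]. Qed.

Lemma runs_minus s x y z (Q : state -> Prop) :
  Q (set_reg s x (regs s y - regs s z)) -> runs (Minus x y z) s 1 Q.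
Proof. by move=> q; eexists _, 1; split; [constructor| |exact: q]. Qed.

Lemma runs_read s x y (Q : state -> Prop) :
  Q (set_reg s x (memory s (regs s y))) -> runs (Read x y) s 1 Q.
Proof. by move=> q; eexists _, 1; split; [constructor| |exact: q]. Qed.

Lemma runs_write s x y (Q : state -> Prop) :
  Q (Defs.set_mem s (regs s x) (regs s y)) -> runs (Write x y) s 1 Q.
Proof. by move=> q; eexists _, 1; split; [constructor| |exact: q]. Qed.

Lemma runs_if s x P P' c Q :
  (regs s x != 0 -> runs P s c Q) -> (regs s x = 0 -> runs P' s c Q) ->
  runs (IfNZ x P P') s c.+1 Q.
Proof.
move=> hP hP'; have [z|nz] := eqVneq (regs s x) 0.
  have [s' [T [e l q]]] := hP' z.
  by exists s', T.+1; split=> //; exact: exec_if_z.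
have [s' [T [e l q]]] := hP nz.
by exists s', T.+1; split=> //; exact: exec_if_nz.
Qed.

(** The invariant is indexed by the number of rounds left. A round adds one test and one decrement
    to the cost of the body, and the last test fails. The decrement comes first, so the body sees
    the values [m - 1] down to 0. *)
Lemma runs_loop x P c (Inv : nat -> state -> Prop) m s :
  (forall i s, Inv i s -> regs s one = 1 /\ regs s x = i) ->
  (forall i s, Inv i.+1 s -> runs P (set_reg s x i) c (Inv i)) ->
  Inv m s -> runs (loop x P) s (m * (c + 2) + 1) (Inv 0).
Proof.
move=> hreg step; elim: m s => [|m IH] s inv.
  by exists s, 1; split=> //; apply: exec_while_z; have [_ ->] := hreg _ _ inv.
have [h1 hx] := hreg _ _ inv.
have [s1 [T1 [e1 l1 i1]]] := step _ _ inv.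
have [s2 [T2 [e2 l2 i2]]] := IH _ i1.
exists s2, ((1 + T1) + T2).+1; split=> //; last by lia.
apply: exec_while_nz e2; first by rewrite hx.
apply: exec_seq e1.
have -> : m = regs s x - regs s one by rewrite hx h1 subn1.
exact: exec_sub.
Qed.

Definition keeps (d : nat) (s s' : state) :=
  forall y, ~~ odd y || (y < tmp d) -> regs s' y = regs s y.

Definition keeps_mem (N : nat) (s s' : state) :=
  forall a, a < N -> memory s' a = memory s a.

Lemma updE f x v y : upd f x v y = if y == x then v else f y.
Proof. by []. Qed.

Ltac reg := rewrite ?/set_reg ?/Defs.set_mem ?/tmp ?/var ?/fuel ?/one ?/zero /=;
  rewrite ?updE; repeat (case: eqP => ?); try lia.

(** * Correctness of the compiler *)

Section Correctness.
Variables (w : seq nat) (B : nat).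
Hypothesis size_w : size w <= B.

(** [sim_out] is there for [fetch], which returns 0 outside a region, so that [A] must vanish there
    as well. *)
Record sim (cur : nat) (rho A : nat -> nat) (s : state) : Prop := Sim {
  sim_fuel : regs s fuel = B;
  sim_one : regs s one = 1;
  sim_zero : regs s zero = 0;
  sim_var : forall x, regs s (var x) = rho x;
  sim_in : forall a, a < B -> memory s a = nth 0 w a;
  sim_arr : forall a, a < B -> memory s (a + B * cur) = A a;
  sim_out : forall a, B <= a -> A a = 0 }.

Lemma runs_shift s x m (Q : state -> Prop) : x != fuel ->
  (forall s', memory s' = memory s -> regs s' x = regs s x + regs s fuel * m ->
     (forall y, y != x -> regs s' y = regs s y) -> Q s') ->
  runs (shift x m) s m.+1 Q.
Proof.
move=> xf; elim: m s => [|m IH] s hQ /=.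
  by apply: runs_skip; apply: hQ => //; lia.
have -> : m.+2 = 1 + m.+1 by lia.
apply: runs_seq; apply: runs_plus; apply: IH => s' mem x' y'.
apply: hQ; rewrite ?mem //.
  rewrite x'; move: xf; rewrite /set_reg /= !updE eqxx eq_sym => /negPf ->; lia.
by move=> y yx; rewrite y' // /set_reg /= updE (negPf yx).
Qed.

Definition keeps_but (d x : nat) (s s' : state) :=
  forall y, ~~ odd y || (y < tmp d) -> y != var x -> regs s' y = regs s y.

Lemma sim_but cur fr rho A d x s s' : 0 < cur < fr ->
  sim cur rho A s -> keeps_but d x s s' -> keeps_mem (B * fr) s s' ->
  sim cur (upd rho x (regs s' (var x))) A s'.
Proof.
move=> /andP[c0 cf] [f o z v i a h] k km; split=> //.
- by rewrite k // /fuel /var; lia.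
- by rewrite k // /one /var; lia.
- by rewrite k // /zero /var; lia.
- move=> y; rewrite updE; case: eqP => [->//|yx].
  by rewrite k ?v // /var; lia.
- by move=> b hb; rewrite km ?i //; nia.
- by move=> b hb; rewrite km ?a //; nia.
Qed.

Lemma sim_keeps cur fr rho A d s s' : 0 < cur < fr ->
  sim cur rho A s -> keeps d s s' -> keeps_mem (B * fr) s s' ->
  sim cur rho A s'.
Proof.
move=> /andP[c0 cf] [f o z v i a h] k km; split=> //.
- by rewrite k.
- by rewrite k.
- by rewrite k.
- by move=> y; rewrite k ?v // /var; lia.
- by move=> b hb; rewrite km ?i //; nia.
- by move=> b hb; rewrite km ?a //; nia.
Qed.

Lemma runs_mov s x y (Q : state -> Prop) : regs s zero = 0 ->
  Q (set_reg s x (regs s y)) -> runs (mov x y) s 1 Q.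
Proof. by move=> z q; apply: runs_plus; rewrite z addn0. Qed.

Lemma runs_clip s x o (Q : state -> Prop) : x != o -> o != fuel -> x != fuel ->
  regs s fuel = B ->
  (forall s', memory s' = memory s -> regs s' x = minn (regs s x) B ->
     (forall y, y != x -> y != o -> regs s' y = regs s y) -> Q s') ->
  runs (clip x o) s 2 Q.
Proof.
move=> xo of_ xf fB hQ; apply: (@runs_seq _ _ _ 1 1); apply: runs_minus.
apply: runs_minus; apply: hQ => //.
  by move: xf fB; rewrite /fuel; reg.
by move=> y yx yo; reg.
Qed.

(* A read beyond the region of length [B] returns 0. *)
Lemma runs_fetch s d m (Q : state -> Prop) : regs s fuel = B ->
  (forall s', memory s' = memory s ->
     regs s' (tmp d) =
       (if regs s (tmp d) < B then memory s (regs s (tmp d) + B * m) else 0) ->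
     keeps d s s' -> Q s') ->
  runs (fetch d m) s (m + 4) Q.
Proof.
move=> fB hQ; have -> : m + 4 = 1 + (m.+1 + 1).+1 by lia.
apply: runs_seq; apply: runs_minus; apply: runs_if.
  rewrite {1}/set_reg /= !updE eqxx fB => lt.
  apply: runs_seq; apply: runs_shift; first by [].
  move=> s' mem' x' k'; apply: runs_read; apply: hQ => //.
    rewrite mem' x' ifT /=; last by lia.
    by move: fB; reg; move=> ->.
  move=> y hy; rewrite /set_reg /= updE ifF; last by move: hy; rewrite /tmp; lia.
  by rewrite k'; reg; move: hy; rewrite /tmp; lia.
rewrite {1}/set_reg /= !updE eqxx fB => ge.
apply: (@runs_le _ _ 1); last by lia.
apply: runs_const; apply: hQ => //.
  by rewrite ifF; [reg|lia].
by move=> y; reg.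
Qed.

Definition keeps_out (m n : nat) (s s' : state) :=
  forall a, a < B * n -> ~~ (B * m <= a < B * m.+1) -> memory s' a = memory s a.

(** Cells are filled from the top down. [P] meets states in which region [m] is partly overwritten;
    hence its hypothesis promises the old memory only outside that region. *)
Lemma runs_tabulate s d x m n P c f (Q : state -> Prop) : m < n ->
  regs s fuel = B -> regs s one = 1 -> regs s zero = 0 ->
  (forall r s', r < B -> keeps_but d x s s' -> keeps_out m n s s' ->
     regs s' (tmp d) = r -> regs s' (var x) = r ->
     runs P s' c (fun s'' => [/\ regs s'' (tmp d.+1) = f r, keeps d.+1 s' s''
                               & keeps_mem (B * n) s' s''])) ->
  (forall s', keeps_but d x s s' -> keeps_out m n s s' ->
     (forall r, r < B -> memory s' (r + B * m) = f r) -> Q s') ->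
  runs (tabulate d x m P) s (B * (c + m + 6) + 2) Q.
Proof.
move=> mn fB o1 z0 hP hQ.
have -> : B * (c + m + 6) + 2 = 1 + (B * ((1 + (c + (1 + (m.+1 + 1)))) + 2) + 1).
  by lia.
apply: runs_seq; apply: runs_mov => //.
pose Inv i st := [/\ regs st (tmp d) = i, i <= B, keeps_but d x s st,
  keeps_out m n s st & forall r, i <= r < B -> memory st (r + B * m) = f r].
apply: (@runs_imp _ _ _ (Inv 0)); last first.
  by move=> s' [_ _ k ko tab]; apply: hQ => // r rB; apply: tab.
apply: (@runs_loop _ _ _ Inv B).
- by move=> i st [ti _ k _ _]; split=> //; rewrite k //= ?o1 //; rewrite /one /var; lia.
- move=> i st [ti iB k ko tab].
  have st0 : regs st zero = 0 by rewrite k ?z0 // /zero /var; lia.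
  have stB : regs st fuel = B by rewrite k ?fB // /fuel /var; lia.
  apply: runs_seq; apply: runs_mov; first by reg.
  set st1 := set_reg _ _ _.
  have kb1 : keeps_but d x s st1.
    move=> y hy yx; rewrite /st1 /= !updE (negPf yx) ifF ?k //.
    by move: hy; rewrite /tmp; lia.
  have t1 : regs st1 (tmp d) = i.
    by rewrite /st1 /= !updE eqxx; case: ifP.
  have x1 : regs st1 (var x) = i by rewrite /st1 /= !updE !eqxx.
  apply: runs_seq; apply: runs_imp.
    by apply: (hP i) => //; lia.
  move=> st2 [res k2 km2].
  have c0 : regs st2 zero = 0 by rewrite k2 // kb1 // /zero /var; lia.
  have f2 : regs st2 fuel = B by rewrite k2 // kb1 // /fuel /var; lia.
  apply: runs_seq; apply: runs_mov => //.
  apply: runs_seq; apply: runs_shift; first by [].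
  move=> st3 mem3 a3 k3; apply: runs_write.
  have a3' : regs st3 (tmp d.+2) = i + B * m.
    rewrite a3 /set_reg /= updE eqxx updE /= f2 k2; last by rewrite /tmp; lia.
    by rewrite t1.
  have v3 : regs st3 (tmp d.+1) = f i by rewrite k3 //; [reg|rewrite /tmp; lia].
  rewrite /Defs.set_mem a3' v3; split=> /=.
  + rewrite k3 /set_reg /= ?updE; last by rewrite /tmp; lia.
    by rewrite ifF ?k2 ?t1 //; rewrite /tmp; lia.
  + by lia.
  + move=> y hy yx; rewrite /= k3; last by move: hy; rewrite /tmp; lia.
    rewrite /set_reg /= updE ifF; last by move: hy; rewrite /tmp; lia.
    rewrite k2; last by move: hy; rewrite /tmp; lia.
    exact: kb1.
  + move=> a an out; rewrite /= ?updE ifF; last by move: out; nia.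
    by rewrite mem3 /set_reg /= km2 // /st1 /= ko.
  + move=> r /andP[ir rB]; rewrite /= ?updE; case: eqP => [e|ne].
      by congr f; lia.
    rewrite mem3 /set_reg /= km2; last by nia.
    by rewrite /st1 /= tab //; lia.
- split=> //=; first by reg.
  + move=> y hy yx; rewrite /set_reg /= updE ifF //.
    by move: hy; rewrite /tmp; lia.
  + by move=> r; lia.
Qed.

(** Because of clipping, this depends on [B] and the syntax but on no computed value. The sums are
    nested as the instructions in [comp] are. *)
Fixpoint cost (e : expr) (cur fr : nat) : nat :=
  match e with
  | EVar _ | ECst _ => 1
  | EAdd a b | ESub a b => cost a cur fr + (cost b cur fr + 1)
  | EMul a b => cost a cur fr + (2 + (cost b cur fr + (1 + ((B * 3 + 1) + 1))))
  | EIn a => cost a cur fr + 4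
  | EArr a => cost a cur fr + (cur + 4)
  | ESum x a b =>
      cost a cur fr +
      (2 + (1 + (1 + ((B * (1 + (cost b cur fr + 1) + 2) + 1) + (1 + 1)))))
  | EIter x cnt ini stp idx =>
      cost idx cur fr + (cost cnt cur fr + (2 + (1 +
      ((B * (cost ini cur fr.+2 + fr.+1 + 6) + 2) +
      ((B * (((B * (cost stp fr.+1 fr.+2 + fr + 6) + 2) +
              (B * ((1 + (fr + 4)) + fr.+1 + 6) + 2)) + 2) + 1) +
       (1 + (fr.+1 + 4)))))))
  end.

Definition computes (d fr v : nat) (s s' : state) :=
  [/\ regs s' (tmp d) = v, keeps d s s' & keeps_mem (B * fr) s s'].

Definition correct (e : expr) := forall d cur fr rho A s, 0 < cur < fr ->
  sim cur rho A s ->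
  runs (comp e d cur fr) s (cost e cur fr) (computes d fr (ev w B e rho A) s).

Lemma keeps_trans d s1 s2 s3 : keeps d s1 s2 -> keeps d s2 s3 -> keeps d s1 s3.
Proof. by move=> k k' y hy; rewrite k' ?k. Qed.

Lemma keeps_mem_trans N s1 s2 s3 :
  keeps_mem N s1 s2 -> keeps_mem N s2 s3 -> keeps_mem N s1 s3.
Proof. by move=> k k' a ha; rewrite k' ?k. Qed.

Lemma keeps_set d x v s : tmp d <= x -> odd x -> keeps d s (set_reg s x v).
Proof. by move=> dx ox y hy; reg; move: dx hy; rewrite /tmp; lia. Qed.

Lemma correct_var x : correct (EVar x).
Proof.
move=> d cur fr rho A s cf sm; apply: runs_mov; first exact: sim_zero sm.
split; last by [].
  by rewrite /= updE eqxx (sim_var sm).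
by apply: keeps_set => //; rewrite /tmp; lia.
Qed.

Lemma correct_cst c : correct (ECst c).
Proof.
move=> d cur fr rho A s cf sm; apply: runs_const; split; last by [].
  by rewrite /= updE eqxx.
by apply: keeps_set => //; rewrite /tmp; lia.
Qed.

Lemma correct_add a b : correct a -> correct b -> correct (EAdd a b).
Proof.
move=> ha hb d cur fr rho A s cf sm; apply: runs_seq.
apply: runs_imp (ha d _ _ _ _ _ cf sm) _ => s1 [v1 k1 m1].
have sm1 := sim_keeps cf sm k1 m1.
apply: runs_seq; apply: runs_imp (hb d.+1 _ _ _ _ _ cf sm1) _ => s2 [v2 k2 m2].
apply: runs_plus; split=> [|y hy|]; last exact: keeps_mem_trans m1 m2.
  by rewrite /= updE eqxx v2 k2 ?v1 //; rewrite /tmp; lia.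
by rewrite /= updE ifF ?k2 ?k1 //; move: hy; rewrite /tmp; lia.
Qed.

Lemma correct_sub a b : correct a -> correct b -> correct (ESub a b).
Proof.
move=> ha hb d cur fr rho A s cf sm; apply: runs_seq.
apply: runs_imp (ha d _ _ _ _ _ cf sm) _ => s1 [v1 k1 m1].
have sm1 := sim_keeps cf sm k1 m1.
apply: runs_seq; apply: runs_imp (hb d.+1 _ _ _ _ _ cf sm1) _ => s2 [v2 k2 m2].
apply: runs_minus; split=> [|y hy|]; last exact: keeps_mem_trans m1 m2.
  by rewrite /= updE eqxx v2 k2 ?v1 //; rewrite /tmp; lia.
by rewrite /= updE ifF ?k2 ?k1 //; move: hy; rewrite /tmp; lia.
Qed.

Lemma correct_in a : correct a -> correct (EIn a).
Proof.
move=> ha d cur fr rho A s cf sm; apply: runs_seq.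
apply: runs_imp (ha d _ _ _ _ _ cf sm) _ => s1 [v1 k1 m1].
have sm1 := sim_keeps cf sm k1 m1.
apply: runs_fetch => [|s2 m2 v2 k2]; first exact: sim_fuel sm1.
split; first last.
- by move=> i hi; rewrite m2 m1.
- exact: keeps_trans k1 k2.
rewrite v2 v1 muln0 addn0 /=; case: ltnP => [lt|ge]; first exact: (sim_in sm1).
by rewrite nth_default //; exact: leq_trans size_w ge.
Qed.

Lemma correct_arr a : correct a -> correct (EArr a).
Proof.
move=> ha d cur fr rho A s cf sm; apply: runs_seq.
apply: runs_imp (ha d _ _ _ _ _ cf sm) _ => s1 [v1 k1 m1].
have sm1 := sim_keeps cf sm k1 m1.
apply: runs_fetch => [|s2 m2 v2 k2]; first exact: sim_fuel sm1.
split; first last.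
- by move=> i hi; rewrite m2 m1.
- exact: keeps_trans k1 k2.
rewrite v2 v1 /=; case: ltnP => [lt|ge]; first exact: (sim_arr sm1).
by rewrite (sim_out sm).
Qed.

Lemma correct_mul a b : correct a -> correct b -> correct (EMul a b).
Proof.
move=> ha hb d cur fr rho A s cf sm; apply: runs_seq.
apply: runs_imp (ha d _ _ _ _ _ cf sm) _ => s1 [v1 k1 m1].
have sm1 := sim_keeps cf sm k1 m1.
apply: runs_seq; apply: runs_clip => //.
- by rewrite /tmp; lia.
- exact: sim_fuel sm1.
move=> s2 m2 v2 k2.
have kd2 : keeps d s1 s2.
  by move=> y hy; apply: k2; move: hy; rewrite /tmp; lia.
have mm2 : keeps_mem (B * fr) s1 s2 by move=> i hi; rewrite m2.
have sm2 := sim_keeps cf sm1 kd2 mm2.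
apply: runs_seq; apply: runs_imp (hb d.+1 _ _ _ _ _ cf sm2) _ => s3 [v3 k3 m3].
apply: runs_seq; apply: runs_const.
apply: runs_seq; set m := minn (ev w B a rho A) B.
set vb := ev w B b rho A.
have sm3 := sim_keeps cf sm2 k3 m3.
pose Inv i st := [/\ regs st (tmp d) = i, regs st (tmp d.+1) = vb,
  regs st (tmp d.+2) = (m - i) * vb, i <= m
  & keeps d s3 st /\ keeps_mem (B * fr) s3 st].
apply: (@runs_le _ _ (m * (1 + 2) + 1)); last first.
  by rewrite leq_add2r leq_mul2r geq_minr orbT.
apply: (@runs_imp _ _ _ (Inv 0)).
  apply: (@runs_loop _ _ _ Inv m).
  - move=> i st [ti _ _ _ [k _]]; split=> //.
    by rewrite k // (sim_one sm3).
  - move=> i st [ti tb tc im [k km]]; apply: runs_plus; split=> /=.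
    + by reg.
    + by move: tb; rewrite /tmp; reg.
    + rewrite !updE eqxx !ifF; try by rewrite /tmp; lia.
      by rewrite tb tc -mulSnr; congr (_ * _); lia.
    + exact: ltnW.
    + split=> // y hy; rewrite /= !updE !ifF ?k //; by move: hy; rewrite /tmp; lia.
  - split=> //=.
    + rewrite !updE ifF; last by rewrite /tmp; lia.
      by rewrite k3 ?v2 ?v1 //; rewrite /tmp; lia.
    + by rewrite !updE ifF ?v3 //; rewrite /tmp; lia.
    + by rewrite !updE eqxx subnn.
    + by split=> // y hy; rewrite /= !updE ifF //; move: hy; rewrite /tmp; lia.
move=> s4 [_ _ v4 _ [k4 m4]].
apply: runs_mov; first by rewrite k4 // (sim_zero sm3).
split=> /=.
- by rewrite updE eqxx v4 subn0.
- move=> y hy; rewrite /= updE ifF; last by move: hy; rewrite /tmp; lia.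
  rewrite k4 // k3 ?kd2 ?k1 //; by move: hy; rewrite /tmp; lia.
- by move=> i hi; rewrite /= m4 // m3 // m2 // m1.
Qed.

Lemma correct_sum x a b : correct a -> correct b -> correct (ESum x a b).
Proof.
move=> ha hb d cur fr rho A s cf sm; apply: runs_seq.
apply: runs_imp (ha d _ _ _ _ _ cf sm) _ => s1 [v1 k1 m1].
have sm1 := sim_keeps cf sm k1 m1.
apply: runs_seq; apply: runs_clip => //.
- by rewrite /tmp; lia.
- exact: sim_fuel sm1.
move=> s2 m2 v2 k2.
have kd2 : keeps d s1 s2.
  by move=> y hy; apply: k2; move: hy; rewrite /tmp; lia.
have mm2 : keeps_mem (B * fr) s1 s2 by move=> i hi; rewrite m2.
have sm2 := sim_keeps cf sm1 kd2 mm2.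
apply: runs_seq; apply: runs_mov; first exact: sim_zero sm2.
apply: runs_seq; apply: runs_const.
set m := minn (ev w B a rho A) B.
pose F v := ev w B b (upd rho x v) A.
set s3 := set_reg _ _ _.
have k3 : keeps d s2 s3.
  by move=> y hy; rewrite /= !updE !ifF //; move: hy; rewrite /tmp; lia.
have m3 : keeps_mem (B * fr) s2 s3 by [].
have sm3 := sim_keeps cf sm2 k3 m3.
pose Inv i st := [/\ regs st (tmp d) = i, regs st (tmp d.+1) = rho x,
  regs st (tmp d.+2) = \sum_(i <= v < m) F v, i <= m
  & keeps_but d x s3 st /\ keeps_mem (B * fr) s3 st].
apply: runs_seq.
apply: (@runs_le _ _ (m * (1 + (cost b cur fr + 1) + 2) + 1)); last first.
  by rewrite leq_add2r leq_mul2r geq_minr orbT.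
apply: (@runs_imp _ _ _ (Inv 0)).
  apply: (@runs_loop _ _ _ Inv m).
  - move=> i st [ti _ _ _ [k _]]; split=> //.
    by rewrite k ?(sim_one sm3) // /one /var; lia.
  - move=> i st [ti tb tc im [k km]].
    have zst : regs st zero = 0.
      by rewrite k ?(sim_zero sm3) // /zero /var; lia.
    apply: runs_seq; apply: runs_mov; first by move: zst; reg.
    set st1 := set_reg _ _ _.
    have kb : keeps_but d x s3 st1.
      move=> y hy yx; rewrite /st1 /= !updE (negPf yx) ifF ?k //.
      by move: hy; rewrite /tmp; lia.
    have xi : regs st1 (var x) = i by rewrite /st1 /= !updE !eqxx.
    have td1 : regs st1 (tmp d) = i by rewrite /st1 /= !updE eqxx; case: ifP.
    have tb1 j : j > 0 -> regs st1 (tmp (d + j)) = regs st (tmp (d + j)).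
      by move=> j0; rewrite /st1 /= !updE !ifF //; rewrite /tmp /var; lia.
    have sm4 := sim_but cf sm3 kb km; rewrite xi in sm4.
    apply: runs_seq; apply: runs_imp (hb d.+3 _ _ _ _ _ cf sm4) _.
    move=> st2 [r2 kk2 km2]; apply: runs_plus; split=> /=.
    + rewrite updE ifF ?kk2 ?td1 //; rewrite /tmp; lia.
    + rewrite updE ifF ?kk2; try by rewrite /tmp; lia.
      by have := tb1 1 isT; rewrite addn1 => ->.
    + rewrite updE eqxx r2 kk2; last by rewrite /tmp; lia.
      have := tb1 2 isT; rewrite addn2 => ->; rewrite tc.
      by rewrite [RHS]big_ltn // addnC.
    + exact: ltnW.
    + split=> [y hy yx|c hc].
        rewrite /= updE ifF ?kk2 ?kb //; by move: hy; rewrite /tmp; lia.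
      by rewrite /= km2 // km.
  - split=> //=.
    + rewrite !updE !ifF ?v2 ?v1 //; rewrite /tmp; lia.
    + rewrite !updE ifF ?eqxx; last by rewrite /tmp; lia.
      exact: (sim_var sm2).
    + by rewrite updE eqxx big_geq.
move=> s4 [_ o4 v4 _ [k4 m4]].
have z4 : regs s4 zero = 0 by rewrite k4 ?(sim_zero sm3) // /zero /var; lia.
apply: runs_seq; apply: runs_mov => //; apply: runs_mov.
  by rewrite /= updE ifF // /zero /var; lia.
split=> /=.
- rewrite updE eqxx updE ifF ?v4 ?big_mkord //; rewrite /tmp /var; lia.
- move=> y hy; rewrite /= updE ifF; last by move: hy; rewrite /tmp; lia.
  rewrite updE; case: eqP => [->|/eqP yx]; first by rewrite o4 (sim_var sm).
  by rewrite k4 // k3 // kd2 // k1.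
- by move=> i hi; rewrite /= m4 // m2 // m1.
Qed.

Lemma sim_region cur fr rho A d x s s' c A' : 0 < cur < fr ->
  sim cur rho A s -> keeps_but d x s s' -> keeps_mem (B * fr) s s' ->
  (forall a, a < B -> memory s' (a + B * c) = A' a) ->
  (forall a, B <= a -> A' a = 0) ->
  sim c (upd rho x (regs s' (var x))) A' s'.
Proof. by move=> cf sm k km hA h0; have [] := sim_but cf sm k km. Qed.

Lemma keeps_but_trans d x s1 s2 s3 :
  keeps_but d x s1 s2 -> keeps_but d x s2 s3 -> keeps_but d x s1 s3.
Proof. by move=> k k' y hy yx; rewrite k' ?k. Qed.

Lemma keeps_butS d d' x s s' : d <= d' -> keeps_but d' x s s' -> keeps_but d x s s'.
Proof. by move=> dd k y hy; apply: k; move: hy; rewrite /tmp; lia. Qed.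

Lemma correct_iter x cnt ini stp idx : correct cnt -> correct ini ->
  correct stp -> correct idx -> correct (EIter x cnt ini stp idx).
Proof.
move=> hc hi hs hx d cur fr rho A s cf sm.
pose cini := B * (cost ini cur fr.+2 + fr.+1 + 6) + 2.
pose cstp := (B * (cost stp fr.+1 fr.+2 + fr + 6) + 2) +
  (B * ((1 + (fr + 4)) + fr.+1 + 6) + 2).
rewrite [cost _ _ _](_ : _ = cost idx cur fr + (cost cnt cur fr + (2 + (1 +
  (cini + ((B * (cstp + 2) + 1) + (1 + (fr.+1 + 4)))))))) //.
apply: runs_seq.
apply: runs_imp (hx d _ _ _ _ _ cf sm) _ => s1 [v1 k1 m1].
have sm1 := sim_keeps cf sm k1 m1.
apply: runs_seq; apply: runs_imp (hc d.+1 _ _ _ _ _ cf sm1) _ => s2 [v2 k2 m2].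
have sm2 := sim_keeps cf sm1 k2 m2.
apply: runs_seq; apply: runs_clip => //.
- by rewrite /tmp; lia.
- exact: sim_fuel sm2.
move=> s3 m3 v3 k3.
have kd3 : keeps d.+1 s2 s3.
  by move=> y hy; apply: k3; move: hy; rewrite /tmp; lia.
have mm3 : keeps_mem (B * fr) s2 s3 by move=> i ?; rewrite m3.
have sm3 := sim_keeps cf sm2 kd3 mm3.
apply: runs_seq; apply: runs_mov; first exact: sim_zero sm3.
set vi := ev w B idx rho A in v1.
set m := minn (ev w B cnt rho A) B.
set s4 := set_reg _ _ _.
have k4 : keeps d.+2 s3 s4 by apply: keeps_set; rewrite /tmp; lia.
have sm4 : sim cur rho A s4 by apply: sim_keeps cf sm3 k4 _.
have d4 : regs s4 (tmp d) = vi.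
  rewrite k4 ?kd3 ?k2 ?v1 //; rewrite /tmp; lia.
have c4 : regs s4 (tmp d.+1) = m.
  by rewrite k4 ?v3 ?v2 //; rewrite /tmp; lia.
have r4 : regs s4 (tmp d.+2) = rho x by rewrite /= updE eqxx (sim_var sm3).
pose A0 r := if r < B then ev w B ini (upd rho x r) A else 0.
pose next (A' : nat -> nat) r := if r < B then ev w B stp (upd rho x r) A' else 0.
pose A_ j := iter j next A0.
have A_out j a : B <= a -> A_ j a = 0.
  by move=> Ba; case: j => [|j]; rewrite /A_ /= /next /A0 ltnNge Ba.
have low n st st' : fr <= n -> n <= fr.+1 -> keeps_out n fr.+2 st st' ->
    keeps_mem (B * fr) st st'.
  by move=> fn nf ko a ha; apply: ko; nia.
apply: runs_seq; apply: (@runs_tabulate _ _ _ _ fr.+2 _ _ A0) => //.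
- exact: sim_fuel sm4.
- exact: sim_one sm4.
- exact: sim_zero sm4.
- move=> r st rB k ko tr xr.
  have smr := sim_but cf sm4 k (low _ _ _ (leqnSn _) (leqnn _) ko).
  rewrite xr in smr; have cf' : 0 < cur < fr.+2 by lia.
  by have := hi d.+4 _ _ _ _ _ cf' smr; rewrite /A0 rB; apply.
move=> s5 k5 ko5 tab5.
have m5 := low _ _ _ (leqnSn _) (leqnn _) ko5.
apply: runs_seq.
(* With [i] rounds left, region [fr.+1] holds the iterate number [m - i]. *)
pose Inv i st := [/\ regs st (tmp d.+1) = i, i <= m, keeps_but d.+1 x s4 st,
  regs st (tmp d.+2) = rho x
  & keeps_mem (B * fr) s4 st /\
    forall r, r < B -> memory st (r + B * fr.+1) = A_ (m - i) r].
apply: (@runs_le _ _ (m * (cstp + 2) + 1)); last first.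
  by rewrite leq_add2r leq_mul2r geq_minr orbT.
apply: (@runs_imp _ _ _ (Inv 0)).
  apply: (@runs_loop _ _ _ Inv m).
  - move=> i st [ti _ k _ _]; split=> //.
    by rewrite k ?(sim_one sm4) // /one /var; lia.
  - move=> i st [ti im k tr [km tab]].
    set st0 := set_reg _ _ _.
    have kb0 : keeps_but d.+1 x s4 st0.
      move=> y hy yx; rewrite /st0 /= updE ifF ?k //.
      by move: hy; rewrite /tmp; lia.
    have t00 : regs st0 (tmp d.+1) = i by rewrite /st0 /= updE eqxx.
    have t02 : regs st0 (tmp d.+2) = rho x.
      by rewrite /st0 /= updE ifF ?tr // /tmp; lia.
    apply: runs_seq.
    apply: (@runs_tabulate _ _ _ _ fr.+2 _ _ (A_ (m - i))) => //.
    + by rewrite kb0 ?(sim_fuel sm4) // /fuel /var; lia.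
    + by rewrite kb0 ?(sim_one sm4) // /one /var; lia.
    + by rewrite kb0 ?(sim_zero sm4) // /zero /var; lia.
    + move=> r st' rB k' ko' tr' xr'.
      have km' : keeps_mem (B * fr) s4 st'.
        move=> a ha; rewrite ko' ?km //; nia.
      have kk' : keeps_but d.+1 x s4 st'.
        by apply: keeps_but_trans kb0 _; apply: keeps_butS k'; lia.
      have tab' a : a < B -> memory st' (a + B * fr.+1) = A_ (m - i.+1) a.
        by move=> aB; rewrite ko' ?tab //; nia.
      have smr := sim_region cf sm4 kk' km' tab' (A_out _).
      rewrite xr' in smr; have cf' : 0 < fr.+1 < fr.+2 by lia.
      have := hs d.+4 _ _ _ _ _ cf' smr.
      have -> : m - i = (m - i.+1).+1 by lia.
      by rewrite [A_ _.+1 r]/= /next rB.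
    move=> st1 kb1 ko1 tab1.
    have kb1' : keeps_but d.+1 x s4 st1.
      by apply: keeps_but_trans kb0 _; apply: keeps_butS kb1; lia.
    have o1 : regs st1 one = 1.
      by rewrite kb1' ?(sim_one sm4) // /one /var; lia.
    have z1 : regs st1 zero = 0.
      by rewrite kb1' ?(sim_zero sm4) // /zero /var; lia.
    have f1 : regs st1 fuel = B.
      by rewrite kb1' ?(sim_fuel sm4) // /fuel /var; lia.
    apply: (@runs_tabulate _ _ _ _ fr.+2 _ _ (A_ (m - i))) => //.
    + move=> r st' rB k' ko' tr' xr'.
      have z' : regs st' zero = 0 by rewrite k' ?z1 // /zero /var; lia.
      have f' : regs st' fuel = B by rewrite k' ?f1 // /fuel /var; lia.
      apply: runs_seq; apply: runs_mov => //.
      apply: runs_fetch; first by move: f'; reg.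
      move=> st'' mem'' v'' k''; split.
      * rewrite v'' /= updE eqxx tr' rB ko' ?tab1 //; nia.
      * by apply: keeps_trans k''; apply: keeps_set; rewrite /tmp; lia.
      * by move=> a ha; rewrite mem''.
    move=> st2 kb2 ko2 tab2.
    split.
    + rewrite kb2 ?kb1 ?t00 //; rewrite /tmp /var; lia.
    + exact: ltnW.
    + by apply: keeps_but_trans kb1' _; apply: keeps_butS kb2; lia.
    + rewrite kb2 ?kb1 ?t02 //; rewrite /tmp /var; lia.
    + split=> // a ha; rewrite ko2 ?ko1 ?km //; nia.
  - split=> //.
    + by rewrite k5 ?c4 //; rewrite /tmp /var; lia.
    + by apply: keeps_butS k5; lia.
    + by rewrite k5 ?r4 //; rewrite /tmp /var; lia.
    + by rewrite subnn; split.
move=> s6 [_ _ k6 r6 [m6 tab6]].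
have z6 : regs s6 zero = 0.
  by rewrite k6 ?(sim_zero sm4) // /zero /var; lia.
have f6 : regs s6 fuel = B.
  by rewrite k6 ?(sim_fuel sm4) // /fuel /var; lia.
have d6 : regs s6 (tmp d) = vi.
  by rewrite k6 ?d4 // /tmp /var; lia.
apply: runs_seq; apply: runs_mov => //.
set s7 := set_reg _ _ _.
have d7 : regs s7 (tmp d) = vi by rewrite /s7 /= updE ifF ?d6 // /tmp /var; lia.
have k7 : keeps d s s7.
  move=> y hy; rewrite /s7 /= updE; case: eqP => [->|/eqP yx].
    by rewrite r6 (sim_var sm).
  by rewrite k6 ?k4 ?kd3 ?k2 ?k1 //; move: hy; rewrite /tmp; lia.
apply: runs_fetch; first by move: f6; rewrite /s7; reg.
move=> s8 m8 v8 k8; split.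
- rewrite v8 d7 /=; case: ltnP => vB.
    by rewrite tab6 // subn0.
  by rewrite -/vi -[LHS](A_out m vi vB).
- exact: keeps_trans k7 k8.
- by move=> a ha; rewrite m8 /s7 /= m6 // mm3 // m2 // m1.
Qed.

Lemma comp_correct e : correct e.
Proof.
elim: e => [x|c|a ha b hb|a ha b hb|a ha b hb|a ha|a ha|x a ha b hb
           |x cnt hc ini hi stp hs idx hx].
- exact: correct_var.
- exact: correct_cst.
- exact: correct_add.
- exact: correct_sub.
- exact: correct_mul.
- exact: correct_in.
- exact: correct_arr.
- exact: correct_sum.
- exact: correct_iter.
Qed.

End Correctness.

(** * Polynomial running time *)

Definition poly_bounded (f : nat -> nat) :=
  exists c d, forall B, f B <= c * B.+1 ^ d.

Lemma poly_bounded_cst c : poly_bounded (fun=> c).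
Proof. by exists c, 0 => B; rewrite expn0 muln1. Qed.

Lemma poly_bounded_id : poly_bounded (fun B => B).
Proof. by exists 1, 1 => B; rewrite expn1 mul1n. Qed.

Lemma poly_bounded_add f g :
  poly_bounded f -> poly_bounded g -> poly_bounded (fun B => f B + g B).
Proof.
move=> [c [d hf]] [c' [d' hg]]; exists (c + c'), (d + d') => B.
(* Powers of [B.+1] are positive even at [B = 0], so each of the two is at most their product. *)
have p j : 0 < B.+1 ^ j by rewrite expn_gt0.
have := hf B; have := hg B; have := p d; have := p d'.
rewrite expnD; nia.
Qed.

Lemma poly_bounded_mul f g :
  poly_bounded f -> poly_bounded g -> poly_bounded (fun B => f B * g B).
Proof.
move=> [c [d hf]] [c' [d' hg]]; exists (c * c'), (d + d') => B.
by rewrite expnD mulnACA leq_mul.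
Qed.

Lemma poly_bounded_cost e cur fr : poly_bounded (fun B => cost B e cur fr).
Proof.
elim: e cur fr => [x|c|a ha b hb|a ha b hb|a ha b hb|a ha|a ha|x a ha b hb
           |x cnt hc ini hi stp hs idx hx] cur fr /=;
  by repeat (apply: poly_bounded_cst || assumption || apply: poly_bounded_id
    || apply: poly_bounded_add || apply: poly_bounded_mul || auto).
Qed.

Lemma poly_bounded_pow f d : poly_bounded f -> poly_bounded (fun B => f B ^ d).
Proof.
move=> hf; elim: d => [|d IH]; first exact: poly_bounded_cst.
have [c [e h]] := poly_bounded_mul hf IH.
by exists c, e => B; rewrite expnS.
Qed.

Lemma poly_bounded_comp f g :
  poly_bounded f -> poly_bounded g -> poly_bounded (fun B => f (g B)).
Proof.
move=> [c [d hf]] hg.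
have [c' [d' h]] : poly_bounded (fun B => c * (g B + 1) ^ d).
  apply: poly_bounded_mul (poly_bounded_cst c) (poly_bounded_pow _ _).
  exact: poly_bounded_add hg (poly_bounded_cst 1).
by exists c', d' => B; apply: leq_trans (hf _) _; rewrite -addn1.
Qed.

Fixpoint power (D : nat) : program :=
  if D is D'.+1 then
    Seq (mov (tmp 1) (tmp 0))
    (Seq (Const (tmp 2) 0)
    (Seq (loop (tmp 1) (Plus (tmp 2) (tmp 2) fuel))
    (Seq (mov fuel (tmp 2)) (power D'))))
  else Skip.

(** The fuel [(c + n) ^ D] is computed first, from the number [n] in input cell 0. Register 0 holds
    the fuel during the run and receives the answer only at the end. *)
Definition main (c D : nat) (e : expr) : program :=
  Seq (Const one 1)
  (Seq (Read (var 0) zero)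
  (Seq (Read (var 1) one)
  (Seq (Const (tmp 0) c)
  (Seq (Plus (tmp 0) (tmp 0) (var 0))
  (Seq (Const fuel 1)
  (Seq (power D)
  (Seq (comp e 0 1 2)
    (mov 0 (tmp 0))))))))).

Definition initial_env (w : seq nat) :=
  upd (upd (fun=> 0) 0 (nth 0 w 0)) 1 (nth 0 w 1).

Definition eval_expr (w : seq nat) (c D : nat) (e : expr) : nat :=
  ev w ((c + nth 0 w 0) ^ D) e (initial_env w) (fun=> 0).

Lemma runs_power D s (Q : state -> Prop) :
  regs s one = 1 -> regs s zero = 0 ->
  (forall s', memory s' = memory s ->
     regs s' fuel = regs s fuel * regs s (tmp 0) ^ D ->
     (forall y, ~~ odd y -> y != fuel -> regs s' y = regs s y) -> Q s') ->
  runs (power D) s (D * (regs s (tmp 0) * 3 + 4) + 1) Q.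
Proof.
elim: D s Q => [|D IH] s Q o1 z0 hQ /=.
  by apply: runs_skip; apply: hQ; rewrite // expn0 muln1.
set b := regs s (tmp 0); set f := regs s fuel.
have -> : D.+1 * (b * 3 + 4) + 1 =
  1 + (1 + ((b * (1 + 2) + 1) + (1 + (D * (b * 3 + 4) + 1)))) by lia.
apply: runs_seq; apply: runs_mov => //; apply: runs_seq; apply: runs_const.
set s1 := set_reg _ _ _.
pose Inv i st := [/\ regs st (tmp 1) = i, i <= b,
  regs st (tmp 2) = (b - i) * f, memory st = memory s
  & forall y, ~~ odd y || (y == tmp 0) -> regs st y = regs s y].
apply: runs_seq; apply: (@runs_imp _ _ _ (Inv 0)).
  apply: (@runs_loop _ _ _ Inv b).
  - by move=> i st [ti _ _ _ k]; split=> //; rewrite k.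
  - move=> i st [ti ib t2 mem k]; apply: runs_plus; split=> //=.
    + exact: ltnW.
    + by rewrite !updE /= t2 k // -mulSnr; congr (_ * _); lia.
    + by move=> y hy; rewrite !updE !ifF ?k //; move: hy; rewrite /tmp; lia.
  - split=> //=; first by rewrite !updE /= subnn.
    by move=> y hy; rewrite !updE !ifF //; move: hy; rewrite /tmp; lia.
move=> s2 [_ _ t2 mem k]; apply: runs_seq; apply: runs_mov; first by rewrite k.
set s3 := set_reg _ _ _.
have b3 : regs s3 (tmp 0) = b by rewrite -[RHS](k (tmp 0)).
rewrite -{1}b3; apply: IH => [||s' mem' f' k'].
- by rewrite -[RHS]o1 -[RHS](k one).
- by rewrite -[RHS]z0 -[RHS](k zero).
apply: hQ; first by rewrite mem' /= mem.
  by rewrite f' b3 [regs s3 _]t2 subn0 expnS mulnA -/f (mulnC f).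
by move=> y oy yf; rewrite k' // /s3 /= ?updE (negPf yf) k ?oy.
Qed.

Lemma runs_main w c D e : 0 < c -> size w <= (c + nth 0 w 0) ^ D ->
  runs (main c D e) (initial_state w)
    (1 + (1 + (1 + (1 + (1 + (1 + (D * ((c + nth 0 w 0) * 3 + 4) + 1 +
          (cost ((c + nth 0 w 0) ^ D) e 1 2 + 1))))))))
    (fun s => regs s 0 = eval_expr w c D e).
Proof.
move=> c0 sz.
apply: runs_seq; apply: runs_const; apply: runs_seq; apply: runs_read.
apply: runs_seq; apply: runs_read; apply: runs_seq; apply: runs_const.
apply: runs_seq; apply: runs_plus; apply: runs_seq; apply: runs_const.
set s1 := set_reg _ _ _.
have t0 : regs s1 (tmp 0) = c + nth 0 w 0 by [].
have v1 x : regs s1 (var x) = initial_env w x.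
  by rewrite /initial_env; case: x => [//|[//|x]]; rewrite /s1; reg.
apply: runs_seq; rewrite -{1}t0; apply: runs_power => // s2 m2 f2 k2.
have {}f2 : regs s2 fuel = (c + nth 0 w 0) ^ D by rewrite f2 t0 mul1n.
have sm2 : sim w ((c + nth 0 w 0) ^ D) 1 (initial_env w) (fun=> 0) s2.
  split=> //.
  - by rewrite k2.
  - by rewrite k2.
  - by move=> x; rewrite k2 ?v1 // /var /fuel; lia.
  - by move=> a _; rewrite m2.
  - move=> a _; rewrite m2 /= nth_default // muln1.
    exact: leq_trans sz (leq_addl _ _).
apply: runs_seq.
have cor := @comp_correct _ _ sz e; have ex := cor 0 1 2 _ _ _ isT sm2.
apply: runs_imp ex _ => s3 [v3 k3 _].
apply: runs_mov; first by rewrite k3 // (sim_zero sm2).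
by rewrite /= updE /= v3.
Qed.

(** The number in cell 0 is smaller than the number of cells, and each cell has at least one bit. So
    a cost polynomial in that number is polynomial in the input length. *)
Lemma polytime_eval (I : Type) (enc : I -> seq nat) c D e : 0 < c ->
  (forall x, nth 0 (enc x) 0 < size (enc x) <= (c + nth 0 (enc x) 0) ^ D) ->
  polytime enc (fun x => eval_expr (enc x) c D e != 0).
Proof.
move=> c0 hsz.
have [a [b hT]] : poly_bounded (fun n =>
    1 + (1 + (1 + (1 + (1 + (1 + (D * ((c + n) * 3 + 4) + 1 +
          (cost ((c + n) ^ D) e 1 2 + 1)))))))).
  have hB : poly_bounded (fun n => (c + n) ^ D).
    apply: poly_bounded_pow.
    exact: poly_bounded_add (poly_bounded_cst c) poly_bounded_id.
  have hc := poly_bounded_comp (poly_bounded_cost e 1 2) hB.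
  by repeat (apply: poly_bounded_cst || assumption || apply: poly_bounded_id
    || apply: poly_bounded_add || apply: poly_bounded_mul).
exists (main c D e), a, b => x; have /andP[lt_n le_B] := hsz x.
have [s [T [ex le_T res]]] := runs_main e c0 le_B.
exists s, T; split=> //; last by rewrite res.
apply: leq_trans le_T _; apply: leq_trans (hT _) _.
apply: leq_trans (leq_addr _ _); rewrite leq_mul2l; apply/orP; right.
have le_len : nth 0 (enc x) 0 < input_length (enc x).
  apply: leq_trans lt_n _; rewrite /input_length -sum1_size.
  by apply: leq_sum => i _.
by case: b {hT} => // b; rewrite leq_exp2r.
Qed.

(** * Expected traces *)

Local Open Scope ring_scope.

Fixpoint mpow (R : realFieldType) (J : finType) (M : J -> J -> R) l r r' : R :=
  if l is l'.+1 then \sum_s M r s * mpow M l' s r' else (r == r')%:R.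

Section RandomSubset.
Variables (R : realFieldType) (E : finType) (p : R).

Definition expect (F : {set E} -> R) : R :=
  \sum_(H : {set E}) (\prod_e (if e \in H then p else 1 - p)) * F H.

Lemma expect_sum (J : finType) (F : J -> {set E} -> R) :
  expect (fun H => \sum_j F j H) = \sum_j expect (F j).
Proof.
rewrite /expect exchange_big /=; apply: eq_bigr => H _.
by rewrite big_distrr.
Qed.

Lemma eq_expect F G : F =1 G -> expect F = expect G.
Proof. by move=> FG; apply: eq_bigr => H _; rewrite FG. Qed.

(** Independence of the events [e \in H]: the expanded product of sums has one term for each
    subset. *)
Lemma expect_prod (g : E -> bool -> R) :
  expect (fun H => \prod_e g e (e \in H)) =
  \prod_e (p * g e true + (1 - p) * g e false).
Proof.
rewrite bigA_distr /expect; apply: eq_bigr => H _.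
by rewrite -big_split; apply: eq_bigr => e _ /=; case: ifP.
Qed.

End RandomSubset.

Lemma prod_count (R : realFieldType) (E : finType) (f : E -> R) (h : seq E) :
  \prod_(g <- h) f g = \prod_e f e ^+ count_mem e h.
Proof.
elim: h => [|g h IH]; first by rewrite big_nil big1.
rewrite big_cons IH /=; under [RHS]eq_bigr do rewrite exprD.
rewrite big_split /=; congr (_ * _).
rewrite (bigD1 g) //= eqxx big1 ?mulr1 // => e /negPf eg.
by rewrite eq_sym eg.
Qed.

Section Walks.
Variables (R : realFieldType) (E I A B : finType).
Variable edge : I -> A -> B -> option E.
Hypothesis edge_inj : forall i a b i' a' b' e,
  edge i a b = Some e -> edge i' a' b' = Some e -> (i, a, b) = (i', a', b').

Definition weight (u v : R) (H : {set E}) (o : option E) : R :=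
  if o is Some e then (if e \in H then u else - v) else 0.

Definition walk (u v : R) (H : {set E}) (r r' : A * B) : R :=
  \sum_i weight u v H (edge i r.1 r'.2) * weight u v H (edge i r'.1 r.2).

Variables (p u v x y : R).
Hypothesis x0 : 0 <= x.
Hypothesis y0 : 0 <= y.

Fixpoint charge_of (h : seq E) : R :=
  if h is g :: h' then (if g \in h' then y else x) * charge_of h' else 1.

Definition charge1 (o : option E) (h : seq E) : R :=
  if o is Some g then (if g \in h then y else x) else 0.

Lemma charge_of_ge0 h : 0 <= charge_of h.
Proof. by elim: h => [|g h IH] //=; apply: mulr_ge0 => //; case: ifP. Qed.

Lemma charge1_ge0 o h : 0 <= charge1 o h.
Proof. by case: o => //= g; case: ifP. Qed.

Definition charge_mult (m : nat) : R := if m is m'.+1 then x * y ^+ m' else 1.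

Lemma charge_ofE h : charge_of h = \prod_e charge_mult (count_mem e h).
Proof.
elim: h => [|g h IH] /=; first by rewrite big1.
rewrite IH (bigD1 g) //= [in RHS](bigD1 g) //= eqxx mulrA; congr (_ * _).
  rewrite -has_pred1 has_count add1n.
  by case: (count_mem g h) => [|m] //=; rewrite exprS mulrCA.
by apply: eq_bigr => e /negPf eg; rewrite eq_sym eg.
Qed.

Hypothesis moment : forall m, `|p * u ^+ m.+1 + (1 - p) * (- v) ^+ m.+1| <= x * y ^+ m.

(** By independence this is a product over distinct hyperedges. One of multiplicity [m.+1]
    contributes a moment, bounded by one first visit [x] and [m] repetitions [y]. *)
Lemma expect_history h :
  `|expect p (fun H => \prod_(g <- h) weight u v H (Some g))| <= charge_of h.
Proof.
under eq_expect do rewrite prod_count.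
rewrite (expect_prod p (fun e b => (if b then u else - v) ^+ count_mem e h)).
rewrite normr_prod charge_ofE; apply: ler_prod => e _.
rewrite normr_ge0 /=; case: (count_mem e h) => [|m] //=.
by rewrite !expr0 !mulr1 addrC subrK normr1.
Qed.

Lemma sum_mem_le (J : finType) (T : eqType) (f : J -> T) (s : seq T) :
  {in [pred j | f j \in s] &, injective f} ->
  \sum_j ((f j \in s)%:R : R) <= (size s)%:R.
Proof.
move=> inj; rewrite -natr_sum ler_nat.
rewrite -big_mkcond sum1_card -(size_image f); apply: uniq_leq_size.
  by rewrite map_inj_in_uniq ?enum_uniq // => j j'; rewrite !mem_enum; exact: inj.
by move=> _ /mapP[j jP ->]; move: jP; rewrite mem_enum.
Qed.

Let K h i a b : R := (edge i a b \in map Some h)%:R.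

Lemma charge1_le h i a b : charge1 (edge i a b) h <= x + y * K h i a b.
Proof.
rewrite /charge1 /K; case: (edge i a b) => [g|]; last by rewrite addr_ge0 ?mulr_ge0.
rewrite mem_map => [|? ? [] //]; case: ifP => _; rewrite ?mulr1 ?mulr0 ?addr0 //.
by rewrite lerDr.
Qed.

(** The last term pays for the case that both hyperedges of a step coincide, which by [edge_inj]
    forces [a' = a] and [b = b']. *)
Lemma charge1_cons_le h i a b a' b' e : edge i a b = Some e ->
  charge1 (edge i a' b') (e :: h) <=
  x + y * K h i a' b' + y * ((a' == a) && (b == b'))%:R.
Proof.
move=> eE; rewrite /charge1 /K; case fE: (edge i a' b') => [g|]; last first.
  by rewrite !addr_ge0 ?mulr_ge0.
rewrite mem_map => [|? ? [] //]; rewrite inE; case: eqP => [gE|_] /=.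
  rewrite gE in fE; have [-> ->] := edge_inj eE fE.
  by rewrite !eqxx mulr1 lerDr addr_ge0 ?mulr_ge0.
apply: le_trans (_ : x + y * (g \in h)%:R <= _); last by rewrite lerDl mulr_ge0.
by case: ifP => _; rewrite ?mulr1 ?mulr0 ?addr0 // lerDr.
Qed.

(** With [a] fixed, different pairs give different hyperedges, so at most [size h] of them hit the
    history. *)
Lemma sum_K_I_B h a : \sum_(z : I * B) K h z.1 a z.2 <= (size h)%:R.
Proof.
rewrite -(size_map Some); apply: (@sum_mem_le _ _ (fun z => edge z.1 a z.2)).
move=> [i b] [i' b'] /=; rewrite !inE /= => /mapP[e _ E1] _ E2.
by rewrite E2 in E1; have [-> ->] := edge_inj E1 (etrans E2 E1) => //.
Qed.

Lemma sum_K_I_A h b : \sum_(z : I * A) K h z.1 z.2 b <= (size h)%:R.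
Proof.
rewrite -(size_map Some); apply: (@sum_mem_le _ _ (fun z => edge z.1 z.2 b)).
move=> [i a] [i' a'] /=; rewrite !inE /= => /mapP[e _ E1] _ E2.
by rewrite E2 in E1; have [-> ->] := edge_inj E1 (etrans E2 E1) => //.
Qed.

Hypothesis x_I : x * #|I|%:R <= y.
Hypothesis x_A : x * #|A|%:R <= y.
Hypothesis x_B : x * #|B|%:R <= y.
Hypothesis x_IAB : x ^+ 2 * (#|I| * #|A| * #|B|)%:R <= y ^+ 2.

(** The second hyperedge is charged against the history that already contains the first. *)
Definition step_charge h (r s : A * B) i : R :=
  if edge i r.1 s.2 is Some e then charge1 (Some e) h * charge1 (edge i s.1 r.2) (e :: h)
  else 0.

(** Expand [(x + y K1) (x + y K2 + y d)]. A free index together with a factor [x] costs at most [y],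
    and a repetition leaves at most [c] choices. In units of [y ^+ 2] the six sums are at most
    [c^2 + 3 c + 2], which is below [(c + 2)^2]. *)
Lemma step_bound h r c : (size h <= c)%N ->
  \sum_s \sum_i step_charge h r s i <= y ^+ 2 * (c%:R + 2) ^+ 2.
Proof.
case: r => a0 b0 hc.
pose K1 i b := K h i a0 b; pose K2 i a := K h i a b0.
have K01 i a b : 0 <= K h i a b <= 1 by rewrite ler0n lern1 leq_b1.
pose S1 := \sum_b \sum_i K1 i b; pose S2 := \sum_a \sum_i K2 i a.
have cR : (size h)%:R <= c%:R :> R by rewrite ler_nat.
have S1c : S1 <= c%:R.
  apply: le_trans cR; rewrite /S1 exchange_big pair_bigA; exact: sum_K_I_B.
have S2c : S2 <= c%:R.
  apply: le_trans cR; rewrite /S2 exchange_big pair_bigA; exact: sum_K_I_A.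
have S10 : 0 <= S1 by apply: sumr_ge0 => b _; apply: sumr_ge0 => i _; case/andP: (K01 i a0 b).
have S20 : 0 <= S2 by apply: sumr_ge0 => b _; apply: sumr_ge0 => i _; case/andP: (K01 i b b0).
pose d a b : R := ((a == a0) && (b == b0))%:R.
have le1 : \sum_s \sum_i step_charge h (a0, b0) s i <= \sum_a \sum_b \sum_i
    (x ^+ 2 + x * y * K1 i b + x * y * K2 i a + x * y * d a b
     + y ^+ 2 * (K1 i b * K2 i a) + y ^+ 2 * (K1 i b * d a b)).
  rewrite -(pair_bigA _ (fun a b => \sum_i step_charge h (a0, b0) (a, b) i)) /=.
  apply: ler_sum => a _; apply: ler_sum => b _; apply: ler_sum => i _.
  rewrite [leRHS](_ : _ = (x + y * K1 i b) * (x + y * K2 i a + y * d a b)); last ring.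
  rewrite /step_charge /=; have := charge1_le h i a0 b.
  case eE: (edge i a0 b) => [e|] h1.
    apply: ler_pM h1 _.
    - exact: (charge1_ge0 (Some e)).
    - exact: charge1_ge0.
    - exact: charge1_cons_le eE.
  by rewrite !(mulr_ge0, addr_ge0) // /d ?ler0n //; case/andP: (K01 i a0 b) (K01 i a b0) => ? _ /andP[].
apply: (le_trans le1).
have sumC (J : finType) (z : R) : \sum_(j : J) z = #|J|%:R * z.
  by rewrite sumr_const mulr_natl.
pose n1 : R := #|I|%:R; pose n2 : R := #|A|%:R; pose n3 : R := #|B|%:R.
have dE : \sum_a \sum_b d a b = 1.
  rewrite (bigD1 a0) //= [X in X + _](bigD1 b0) //= /d !eqxx /=.
  rewrite [X in _ + X + _]big1 => [|b /negPf ->] //.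
  rewrite big1 ?addr0 // => a /negPf aE; rewrite big1 // => b _.
  by rewrite aE.
have -> : \sum_a \sum_b \sum_i
    (x ^+ 2 + x * y * K1 i b + x * y * K2 i a + x * y * d a b
     + y ^+ 2 * (K1 i b * K2 i a) + y ^+ 2 * (K1 i b * d a b)) =
  n1 * n2 * n3 * x ^+ 2 + x * y * (n2 * S1) + x * y * (n3 * S2) + x * y * n1
  + y ^+ 2 * (\sum_a \sum_b \sum_i K1 i b * K2 i a) + y ^+ 2 * (\sum_i K1 i b0).
  under eq_bigr => a _ do under eq_bigr => b _ do rewrite !big_split -!big_distrr.
  under eq_bigr => a _ do rewrite !big_split -!big_distrr.
  rewrite !big_split -!big_distrr /= -/S1.
  have -> : \sum_(a : A) \sum_(b : B) \sum_(i : I) x = n2 * (n3 * (n1 * x)).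
    by under eq_bigr => a _ do rewrite (eq_bigr _ (fun b _ => sumC I x)) sumC; rewrite sumC.
  have -> : \sum_(a : A) \sum_(b : B) \sum_i K2 i a = n3 * S2.
    by under eq_bigr do rewrite sumC; rewrite -big_distrr.
  have -> : \sum_a \sum_b \sum_(i : I) d a b = n1.
    under eq_bigr => a _ do under eq_bigr do rewrite sumC.
    under eq_bigr do rewrite -big_distrr.
    by rewrite -big_distrr /= dE mulr1.
  have -> : \sum_a \sum_b \sum_i K1 i b * d a b = \sum_i K1 i b0.
    under eq_bigr => a _ do under eq_bigr do rewrite -big_distrl.
    rewrite (bigD1 a0) //= [X in X + _](bigD1 b0) //= /d !eqxx mulr1.
    rewrite [X in _ + X + _]big1 => [|b /negPf ->]; last by rewrite ?andbF mulr0.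
    rewrite addr0 [X in _ + X]big1 ?addr0 // => a /negPf aE; rewrite big1 // => b _.
    by rewrite aE mulr0.
  by rewrite sumC; ring.
(* Decoupling the common vertex [i] only adds nonnegative terms. *)
have T5 : \sum_a \sum_b \sum_i K1 i b * K2 i a <= S1 * S2.
  rewrite mulrC big_distrl; apply: ler_sum => a _ /=.
  rewrite big_distrr; apply: ler_sum => b _ /=.
  rewrite big_distrl; apply: ler_sum => i _ /=; rewrite mulrC ler_wpM2l //.
  rewrite (bigD1 i) //= lerDl; apply: sumr_ge0 => j _.
  by case/andP: (K01 j a0 b).
have T6 : \sum_i K1 i b0 <= S1.
  rewrite /S1 (bigD1 b0) //= lerDl; apply: sumr_ge0 => b _; apply: sumr_ge0 => i _.
  by case/andP: (K01 i a0 b).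
have c0 : 0 <= c%:R :> R by rewrite ler0n.
have T5' : \sum_a \sum_b \sum_i K1 i b * K2 i a <= c%:R * c%:R.
  exact: le_trans T5 (ler_pM S10 S20 S1c S2c).
have B1 : n1 * n2 * n3 * x ^+ 2 <= y ^+ 2 by rewrite mulrC -!natrM.
have B2 : x * y * (n2 * S1) <= y ^+ 2 * c%:R.
  rewrite (_ : x * y * (n2 * S1) = y * ((x * n2) * S1)); last by ring.
  rewrite (_ : y ^+ 2 * c%:R = y * (y * c%:R)); last by ring.
  by rewrite ler_wpM2l // ler_pM // mulr_ge0.
have B3 : x * y * (n3 * S2) <= y ^+ 2 * c%:R.
  rewrite (_ : x * y * (n3 * S2) = y * ((x * n3) * S2)); last by ring.
  rewrite (_ : y ^+ 2 * c%:R = y * (y * c%:R)); last by ring.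
  by rewrite ler_wpM2l // ler_pM // mulr_ge0.
have B4 : x * y * n1 <= y ^+ 2.
  by rewrite mulrAC expr2 ler_wpM2r.
have B5 := ler_wpM2l (sqr_ge0 y) T5'.
have B6 := ler_wpM2l (sqr_ge0 y) (le_trans T6 S1c).
have y2c : 0 <= y ^+ 2 * c%:R by rewrite mulr_ge0 // sqr_ge0.
have y20 := sqr_ge0 y.
rewrite (_ : y ^+ 2 * (c%:R + 2) ^+ 2 =
  y ^+ 2 * (c%:R * c%:R) + 4 * (y ^+ 2 * c%:R) + 4 * y ^+ 2); last by ring.
lra.
Qed.

(** Induction on [l]: unfolding a step of the walk prepends its two hyperedges to [h]. As [c] bounds
    the final length of the history, all steps have the same factor. *)
Lemma expect_walk c l h r r' : (size h + l.*2 <= c)%N ->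
  `|expect p (fun H => (\prod_(g <- h) weight u v H (Some g)) *
      mpow (walk u v H) l r r')| <= charge_of h * (y ^+ 2 * (c%:R + 2) ^+ 2) ^+ l.
Proof.
elim: l h r => [|l IH] h r hc /=.
  rewrite expr0 mulr1; case: eqP => _ /=.
    by under eq_expect do rewrite mulr1; exact: expect_history.
  rewrite [expect _ _]big1 ?normr0 ?charge_of_ge0 // => H _.
  by rewrite !mulr0.
set Z := y ^+ 2 * _.
have Z0 : 0 <= Z by rewrite mulr_ge0 // sqr_ge0.
have -> : expect p (fun H => (\prod_(g <- h) weight u v H (Some g)) *
      \sum_s walk u v H r s * mpow (walk u v H) l s r') =
  \sum_s \sum_i expect p (fun H => (\prod_(g <- h) weight u v H (Some g)) *
    (weight u v H (edge i r.1 s.2) * weight u v H (edge i s.1 r.2)) *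
      mpow (walk u v H) l s r').
  under [RHS]eq_bigr do rewrite -expect_sum.
  rewrite -expect_sum; apply: eq_expect => H.
  rewrite big_distrr /=; apply: eq_bigr => s _.
  by rewrite mulrA /walk big_distrr big_distrl.
apply: le_trans (ler_norm_sum _ _ _) _.
apply: (@le_trans _ _ (\sum_s \sum_i step_charge h r s i * (charge_of h * Z ^+ l))).
  apply: ler_sum => s _; apply: le_trans (ler_norm_sum _ _ _) _.
  apply: ler_sum => i _; rewrite /step_charge.
  case eE: (edge i r.1 s.2) => [e|]; last first.
    by rewrite mul0r [expect _ _]big1 ?normr0 // => H _; rewrite /= !(mul0r, mulr0).
  case fE: (edge i s.1 r.2) => [f|]; last first.
    by rewrite mulr0 mul0r [expect _ _]big1 ?normr0 // => H _; rewrite /= !(mul0r, mulr0).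
  under eq_expect => H.
    rewrite [X in X * _](_ : _ = \prod_(g <- f :: e :: h) weight u v H (Some g)); last first.
      by rewrite !big_cons; ring.
    over.
  apply: le_trans (IH _ _ _) _; first by rewrite /= -addnn; move: hc; rewrite -!addnn; lia.
  by rewrite /=; set w1 := (if f \in _ then _ else _); set w2 := (if _ then _ else _); lra.
under eq_bigr do rewrite -big_distrl.
rewrite -big_distrl /= exprS [leRHS]mulrCA ler_wpM2r ?mulr_ge0 ?charge_of_ge0 ?exprn_ge0 //.
by apply: step_bound; move: hc; lia.
Qed.

End Walks.

(** * Traces bound trilinear forms *)

Local Open Scope ring_scope.

(** Lagrange's identity: the right side minus the left is half the sum of the squares
    [(f i * g j - f j * g i) ^+ 2]. *)
Lemma cauchy_schwarz (R : realFieldType) (J : finType) (f g : J -> R) :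
  (\sum_j f j * g j) ^+ 2 <= (\sum_j f j ^+ 2) * (\sum_j g j ^+ 2).
Proof.
have : 0 <= \sum_i \sum_j (f i * g j - f j * g i) ^+ 2.
  by apply: sumr_ge0 => i _; apply: sumr_ge0 => j _; exact: sqr_ge0.
have -> : \sum_i \sum_j (f i * g j - f j * g i) ^+ 2 =
  \sum_i \sum_j f i ^+ 2 * g j ^+ 2 + \sum_i \sum_j f j ^+ 2 * g i ^+ 2
  - 2 * \sum_i \sum_j (f i * g i) * (f j * g j).
  rewrite mulr_sumr -big_split -sumrB; apply: eq_bigr => i _ /=.
  rewrite mulr_sumr -big_split -sumrB; apply: eq_bigr => j _ /=.
  by ring.
rewrite [X in _ + X - _]exchange_big /=.
have dist (a b : J -> R) : \sum_i \sum_j a i * b j = (\sum_i a i) * \sum_j b j.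
  by rewrite mulr_suml; apply: eq_bigr => i _; rewrite mulr_sumr.
by rewrite !dist expr2; lra.
Qed.

Section SymmetricMatrix.
Variables (R : realFieldType) (J : finType) (M : J -> J -> R).
Hypothesis symM : forall r s, M r s = M s r.

Lemma mpowD m n r r' :
  mpow M (m + n) r r' = \sum_s mpow M m r s * mpow M n s r'.
Proof.
elim: m r => [|m IH] r /=.
  rewrite (bigD1 r) //= eqxx mul1r big1 ?addr0 // => s /negPf sr.
  by rewrite eq_sym sr mul0r.
under eq_bigr do rewrite IH mulr_sumr.
rewrite exchange_big; apply: eq_bigr => s _ /=.
by rewrite mulr_suml; apply: eq_bigr => t _; rewrite mulrA.
Qed.

Lemma mpow1 r s : mpow M 1 r s = M r s.
Proof.
rewrite /= (bigD1 s) //= eqxx mulr1 big1 ?addr0 // => t /negPf ts.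
by rewrite ts mulr0.
Qed.

Lemma mpow_sym m r s : mpow M m r s = mpow M m s r.
Proof.
elim: m r s => [|m IH] r s; first by rewrite /= eq_sym.
rewrite -{2}addn1 mpowD [LHS]/=; apply: eq_bigr => t _.
by rewrite mpow1 mulrC IH symM.
Qed.

(** By symmetry both sides are the squared Frobenius norm of [M^m]. *)
Lemma trace_double m :
  \sum_r mpow M (m + m) r r = \sum_r \sum_s mpow M m r s ^+ 2.
Proof.
apply: eq_bigr => r _; rewrite mpowD; apply: eq_bigr => s _.
by rewrite expr2 (mpow_sym m s).
Qed.

Variable z : J -> R.
(** For [z] as a column vector, [q m] is [z^T M^m z], [w m] is [M^m z] and [nz] is the squared norm
    of [z]. *)
Let q m := \sum_r \sum_s z r * mpow M m r s * z s.
Let w m r := \sum_s mpow M m r s * z s.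
Let nz := \sum_r z r ^+ 2.

Let qE m : q m = \sum_r z r * w m r.
Proof.
by apply: eq_bigr => r _; rewrite mulr_sumr; apply: eq_bigr => s _; rewrite mulrA.
Qed.

Let q_double m : q (m + m) = \sum_r w m r ^+ 2.
Proof.
rewrite /q; under eq_bigr => r _ do under eq_bigr => s _ do
  rewrite mpowD mulr_sumr mulr_suml.
under eq_bigr do rewrite exchange_big.
rewrite exchange_big; apply: eq_bigr => t _ /=.
rewrite expr2 /w mulr_suml; apply: eq_bigr => r _.
rewrite mulr_sumr; apply: eq_bigr => s _.
by rewrite (mpow_sym m r); ring.
Qed.

Let nz0 : 0 <= nz. Proof. by apply: sumr_ge0 => r _; exact: sqr_ge0. Qed.

Let q_sq m : q m ^+ 2 <= nz * q (m + m).
Proof. by rewrite qE q_double; exact: cauchy_schwarz. Qed.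

Let q_pow l : q 1 ^+ (2 ^ l) <= nz ^+ (2 ^ l).-1 * q (2 ^ l).
Proof.
elim: l => [|l IH]; first by rewrite expn0 expr1 expr0 mul1r.
have e2 : (2 ^ l.+1).-1 = ((2 ^ l).-1 * 2 + 1)%N.
  by rewrite expnS; have := expn_gt0 2 l; lia.
have e3 : (2 ^ l.+1 = 2 ^ l + 2 ^ l)%N by rewrite expnS mul2n addnn.
rewrite e2 e3 exprD -expr2.
apply: le_trans (_ : (nz ^+ (2 ^ l).-1 * q (2 ^ l)) ^+ 2 <= _).
  (* Squaring the induction hypothesis needs a nonnegative left side. At [l = 0] this may fail, but
     there both sides agree. *)
  case: l IH {e2 e3} => [|l] IH; first by rewrite !expr1 /= expr0 mul1r.
  have ge0 : 0 <= q 1 ^+ (2 ^ l.+1) by rewrite expnS mulnC exprM sqr_ge0.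
  by rewrite ler_sqr ?nnegrE //; exact: le_trans IH.
rewrite exprMn -exprM exprD expr1 -mulrA.
by apply: ler_wpM2l; rewrite ?exprn_ge0.
Qed.

(** Repeated squaring leads to the squared norm of [M^(2^l) z]. Cauchy-Schwarz in each row bounds it
    by [nz] times the squared Frobenius norm of [M^(2^l)], which is the trace. *)
Lemma form_pow_le_trace l :
  (\sum_r \sum_s z r * M r s * z s) ^+ (2 ^ l.+1) <=
  nz ^+ (2 ^ l.+1) * \sum_r mpow M (2 ^ l.+1) r r.
Proof.
have -> : \sum_r \sum_s z r * M r s * z s = q 1.
  by apply: eq_bigr => r _; apply: eq_bigr => s _; rewrite mpow1.
apply: le_trans (q_pow l.+1) _.
have e : (2 ^ l.+1 = (2 ^ l.+1).-1.+1)%N by rewrite prednK // expn_gt0.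
rewrite [X in _ <= nz ^+ X * _]e exprSr -mulrA.
apply: ler_wpM2l; first exact: exprn_ge0.
rewrite expnS mul2n -addnn q_double trace_double mulr_sumr.
apply: ler_sum => r _; rewrite mulrC; exact: cauchy_schwarz.
Qed.

End SymmetricMatrix.

Section WalkForm.
Variables (R : realFieldType) (E I A B : finType).
Variables (edge : I -> A -> B -> option E) (u v : R) (H : {set E}).
Variables (xI : I -> R) (xA : A -> R) (xB : B -> R).

Let W i a b := weight u v H (edge i a b).

Lemma walk_sym r s : walk edge u v H r s = walk edge u v H s r.
Proof. by apply: eq_bigr => i _; rewrite mulrC. Qed.

(** Cauchy-Schwarz in [i] leaves the sum of [F i ^+ 2]. Expanding the square and exchanging [b] and
    [b'] between its two copies turns this into the quadratic form of [walk] at the vector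
    [xA a * xB b]. *)
Lemma trilinear_pow_le_trace l :
  (\sum_i \sum_a \sum_b xI i * (xA a * xB b * W i a b)) ^+ (2 * 2 ^ l.+1) <=
  ((\sum_i xI i ^+ 2) * (\sum_a xA a ^+ 2) * (\sum_b xB b ^+ 2)) ^+ (2 ^ l.+1)
  * \sum_r mpow (walk edge u v H) (2 ^ l.+1) r r.
Proof.
pose F i := \sum_a \sum_b xA a * xB b * W i a b.
pose z (r : A * B) := xA r.1 * xB r.2.
have -> : \sum_i \sum_a \sum_b xI i * (xA a * xB b * W i a b) = \sum_i xI i * F i.
  apply: eq_bigr => i _; rewrite mulr_sumr; apply: eq_bigr => a _.
  by rewrite mulr_sumr.
have formE : \sum_i F i ^+ 2 = \sum_r \sum_s z r * walk edge u v H r s * z s.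
  under [RHS]eq_bigr => r _ do under eq_bigr => s _ do rewrite mulr_sumr mulr_suml.
  under [RHS]eq_bigr do rewrite exchange_big.
  rewrite [RHS]exchange_big; apply: eq_bigr => i _ /=.
  rewrite -(pair_bigA _ (fun a b => \sum_s z (a, b) * (weight u v H (edge i a s.2)
     * weight u v H (edge i s.1 b)) * z s)) /=.
  under eq_bigr => a _ do under eq_bigr => b _ do
    rewrite -(pair_bigA _ (fun a' b' => z (a, b) * (W i a b' * W i a' b) * z (a', b'))) /=.
  rewrite expr2 {1}/F mulr_suml; apply: eq_bigr => a _.
  under [RHS]eq_bigr do rewrite exchange_big.
  rewrite exchange_big mulr_suml /=; apply: eq_bigr => b _.
  rewrite /F mulr_sumr exchange_big; apply: eq_bigr => a' _ /=.
  by rewrite mulr_sumr; apply: eq_bigr => b' _; rewrite /z /=; ring.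
have nzE : \sum_r z r ^+ 2 = (\sum_a xA a ^+ 2) * (\sum_b xB b ^+ 2).
  rewrite -(pair_bigA _ (fun a b => z (a, b) ^+ 2)) mulr_suml.
  apply: eq_bigr => a _; rewrite mulr_sumr; apply: eq_bigr => b _.
  by rewrite exprMn.
pose nI := \sum_i xI i ^+ 2; pose nA := \sum_a xA a ^+ 2.
pose nB := \sum_b xB b ^+ 2; rewrite -/nI -/nA -/nB.
rewrite exprM (_ : (nI * nA * nB) ^+ _ * _ = nI ^+ (2 ^ l.+1) *
  ((nA * nB) ^+ (2 ^ l.+1) * \sum_r mpow (walk edge u v H) (2 ^ l.+1) r r));
  last by rewrite -[nI * _ * _]mulrA exprMn mulrA.
apply: le_trans (_ : (nI * \sum_i F i ^+ 2) ^+ (2 ^ l.+1) <= _).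
  rewrite lerXn2r ?nnegrE ?sqr_ge0 ?cauchy_schwarz //.
  by rewrite mulr_ge0 // sumr_ge0 // => i _; exact: sqr_ge0.
rewrite exprMn; apply: ler_wpM2l.
  by rewrite exprn_ge0 // sumr_ge0 // => i _; exact: sqr_ge0.
by rewrite formE -nzE; apply: form_pow_le_trace => r s; exact: walk_sym.
Qed.

Lemma trace_walk_ge0 l : 0 <= \sum_r mpow (walk edge u v H) (2 ^ l.+1) r r.
Proof.
rewrite expnS mul2n -addnn trace_double => [|r s]; last exact: walk_sym.
by apply: sumr_ge0 => r _; apply: sumr_ge0 => s _; exact: sqr_ge0.
Qed.

End WalkForm.

(** * Base-n digits and hyperedges *)

Local Open Scope nat_scope.

Definition digits (n k c : nat) : seq nat :=
  [seq (c %/ n ^ i) %% n | i <- iota 0 k].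

Definition undigits (n : nat) (s : seq nat) : nat :=
  foldr (fun d c => d + n * c) 0 s.

Lemma size_digits n k c : size (digits n k c) = k.
Proof. by rewrite size_map size_iota. Qed.

Lemma digitsS n k c : digits n k.+1 c = c %% n :: digits n k (c %/ n).
Proof.
rewrite /digits /= expn0 divn1 -[1]addn0 iotaDl -map_comp; congr (_ :: _).
by apply: eq_map => i /=; rewrite expnS divnMA.
Qed.

Lemma digits_lt n k c : 0 < n -> all (fun v => v < n) (digits n k c).
Proof. by move=> n0; apply/allP => _ /mapP[i _ ->]; rewrite ltn_mod. Qed.

Lemma digitsK n k c : c < n ^ k -> undigits n (digits n k c) = c.
Proof.
elim: k c => [|k IH] c; first by rewrite expn0 ltnS leqn0 => /eqP ->.
case: n IH => [|n] IH; first by rewrite exp0n.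
rewrite expnS => lt_c; rewrite digitsS /= IH; last by rewrite ltn_divLR // mulnC.
by rewrite addnC mulnC -divn_eq.
Qed.

Lemma undigitsK n s : all (fun v => v < n) s ->
  undigits n s < n ^ size s /\ digits n (size s) (undigits n s) = s.
Proof.
elim: s => [|d s IH] //= /andP[dn /IH[lt_s dig_s]].
have n0 : 0 < n by lia.
rewrite digitsS [d + _]addnC [n * _]mulnC modnMDl modn_small // divnMDl //.
by rewrite divn_small // addn0 dig_s expnS; split=> //; nia.
Qed.

Lemma digits_cat n k l x y : x < n ^ k ->
  digits n (k + l) (x + n ^ k * y) = digits n k x ++ digits n l y.
Proof.
elim: k x => [|k IH] x.
  by rewrite expn0 ltnS leqn0 => /eqP ->; rewrite mul1n.
case: n IH => [|n] IH; first by rewrite exp0n.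
move=> xlt; rewrite addSn !digitsS expnS.
have -> : x + n.+1 * n.+1 ^ k * y = n.+1 ^ k * y * n.+1 + x by lia.
rewrite modnMDl divnMDl // [_ * y + _]addnC IH //.
by rewrite ltn_divLR // mulnC -expnS.
Qed.

(** * Increasing codes and sets of vertices *)

Section Tuples.
Variables (n k : nat).

Lemma mem_digit_set c (v : 'I_n) : (v \in digit_set n k c) = (val v \in digits n k c).
Proof.
rewrite inE; apply/existsP/mapP => [[i /eqP e]|[i]].
  by exists (val i); rewrite ?mem_iota ?add0n /= ?ltn_ord.
by rewrite mem_iota => /= ik e; exists (Ordinal ik); rewrite /= -e.
Qed.

Lemma sorted_enum (S : {set 'I_n}) : sorted ltn (map val (enum S)).
Proof.
apply: (subseq_sorted ltn_trans) (iota_ltn_sorted 0 n).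
by rewrite -val_enum_ord map_subseq // enumT /enum_mem filter_subseq.
Qed.

(** A set of [k] vertices has [k!] codes without repeated digits, exactly one of them increasing;
    this one represents the set. *)
Definition increasing c := sorted ltn (digits n k c).

Lemma enum_digit_set c : 0 < n -> increasing c ->
  map val (enum (digit_set n k c)) = digits n k c.
Proof.
move=> n0 inc; apply: (irr_sorted_eq ltn_trans ltnn) (sorted_enum _) inc _ => v.
apply/mapP/idP => [[u]|hv]; first by rewrite mem_enum mem_digit_set => + ->.
have vn : v < n by move/allP: (digits_lt k c n0) => /(_ _ hv).
by exists (Ordinal vn); rewrite // mem_enum mem_digit_set.
Qed.

Lemma card_digit_set c : 0 < n -> increasing c -> #|digit_set n k c| = k.
Proof.
move=> n0 inc; rewrite cardE -(size_map val) enum_digit_set //.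
exact: size_digits.
Qed.

Lemma digit_set_inj c c' : 0 < n -> c < n ^ k -> c' < n ^ k ->
  increasing c -> increasing c' ->
  digit_set n k c = digit_set n k c' -> c = c'.
Proof.
move=> n0 ck ck' inc inc' e; rewrite -(digitsK ck) -(digitsK ck').
by rewrite -!enum_digit_set // e.
Qed.

Lemma digit_set_surj (S : {set 'I_n}) : #|S| = k ->
  exists2 c, c < n ^ k /\ increasing c & digit_set n k c = S.
Proof.
move=> Sk; pose s := map val (enum S).
have sz : size s = k by rewrite size_map -cardE.
have lt_s : all (fun v => v < n) s.
  by apply/allP => _ /mapP[u _ ->]; exact: ltn_ord.
have [lt_c dig] := undigitsK lt_s; rewrite sz in lt_c dig.
exists (undigits n s).
  by split=> //; rewrite /increasing dig sorted_enum.
by apply/setP => v; rewrite mem_digit_set dig (mem_map val_inj) mem_enum.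
Qed.

End Tuples.

Section Edges.
Variables (n al be : nat).
Let k := (1 + (al + be)).

Definition code (i a b : nat) := i + n * (a + n ^ al * b).

Lemma digits_code i a b : i < n -> a < n ^ al ->
  digits n k (code i a b) = i :: digits n al a ++ digits n be b.
Proof.
move=> ltin lta; rewrite /code -{2}[n]expn1 digits_cat ?expn1 //.
by rewrite digits_cat // digitsS modn_small.
Qed.

Lemma code_lt i a b : i < n -> a < n ^ al -> b < n ^ be -> code i a b < n ^ k.
Proof.
move=> hi ha hb; have h : a + n ^ al * b < n ^ (al + be) by rewrite expnD; nia.
by rewrite /code /k expnD expn1; nia.
Qed.

Lemma code_inj i a b i' a' b' : i < n -> i' < n -> a < n ^ al -> a' < n ^ al ->
  code i a b = code i' a' b' -> [/\ i = i', a = a' & b = b'].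
Proof.
rewrite /code => hi hi' ha ha' e.
have n0 : 0 < n by lia.
have m0 : 0 < n ^ al by lia.
have e1 : i = i'.
  by have := congr1 (modn^~ n) e; rewrite /= ![_ + n * _]addnC !(mulnC n) !modnMDl !modn_small.
have e2 : a + n ^ al * b = a' + n ^ al * b' by nia.
have e3 : a = a'.
  by have := congr1 (modn^~ (n ^ al)) e2; rewrite /= ![_ + _ * _]addnC !(mulnC (n ^ al)) !modnMDl !modn_small.
by split=> //; nia.
Qed.

Definition edge (i : 'I_n) (a : 'I_(n ^ al)) (b : 'I_(n ^ be)) :
    option (hyperedge n k) :=
  if increasing n k (code i a b)
  then (insub (digit_set n k (code i a b)) : option {e : {set 'I_n} | #|e| == k})
  else None.

Lemma edge_Some i a b e : edge i a b = Some e ->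
  increasing n k (code i a b) /\ digit_set n k (code i a b) = val e.
Proof.
by rewrite /edge; case: ifP => // inc; case: insubP => // e' _ <- [->].
Qed.

Lemma edge_inj i a b i' a' b' e :
  edge i a b = Some e -> edge i' a' b' = Some e -> (i, a, b) = (i', a', b').
Proof.
move=> /edge_Some[inc1 e1] /edge_Some[inc2 e2].
have n0 : 0 < n by exact: leq_ltn_trans (leq0n _) (ltn_ord i).
have := @digit_set_inj n k _ _ n0 _ _ inc1 inc2.
rewrite e1 e2 => /(_ (code_lt _ _ _) (code_lt _ _ _) erefl) /code_inj h.
have [] := h (ltn_ord _) (ltn_ord _) (ltn_ord _) (ltn_ord _) (ltn_ord _) (ltn_ord _)
  (ltn_ord _) (ltn_ord _) (ltn_ord _) (ltn_ord _).
by move=> /val_inj -> /val_inj -> /val_inj ->.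
Qed.

Lemma edge_surj e : exists i a b, edge i a b = Some e.
Proof.
have [c [lt_c inc] dc] := digit_set_surj (eqP (valP e)).
have n0 : 0 < n by move: lt_c; case: (n) => //; rewrite exp0n.
have m0 : 0 < n ^ al by rewrite expn_gt0 n0.
have hi : c %% n < n by rewrite ltn_mod.
have ha : (c %/ n) %% n ^ al < n ^ al by rewrite ltn_mod.
have hb : (c %/ n) %/ n ^ al < n ^ be.
  rewrite ltn_divLR // -expnD addnC ltn_divLR // mulnC -expnS.
  by move: lt_c; rewrite /k add1n.
exists (Ordinal hi), (Ordinal ha), (Ordinal hb).
have codeE : code (c %% n) ((c %/ n) %% n ^ al) ((c %/ n) %/ n ^ al) = c.
  rewrite /code addnC (mulnC (n ^ al)) [_ %% n ^ al + _]addnC -divn_eq.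
  by rewrite mulnC -divn_eq.
rewrite /edge /= codeE inc dc.
by rewrite (insubT (fun A : {set 'I_n} => #|A| == k) (valP e)); congr Some; apply: val_inj.
Qed.

(** An increasing code has [k] distinct digits, so [insub] cannot fail on it. *)
Lemma edge_None i a b : edge i a b = None -> ~~ increasing n k (code i a b).
Proof.
rewrite /edge; case: ifP => // inc; rewrite insubT //.
by rewrite card_digit_set //; exact: leq_ltn_trans (leq0n _) (ltn_ord i).
Qed.

Lemma nth_encode (H : hypergraph n k) t c : c < n ^ k ->
  nth 0 (encode (Instance H t)) c.+2 = (digit_set n k c \in [set val e | e in H]).
Proof.
by move=> ck; rewrite /encode /= (nth_map 0) ?size_iota // nth_iota.
Qed.

Lemma mem_edge (H : hypergraph n k) i a b e : edge i a b = Some e ->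
  (digit_set n k (code i a b) \in [set val e | e in H]) = (e \in H).
Proof.
by move=> /edge_Some[_ ->]; rewrite (mem_imset _ _ val_inj).
Qed.

Section Independent.
Local Open Scope ring_scope.
Variables (R : realFieldType) (u v : R) (H : hypergraph n k) (S : {set 'I_n}).

Definition inside (s : seq nat) : R := (all (mem (map val (enum S))) s)%:R.

(** Every hyperedge comes from exactly one triple, by [edge_inj] and [edge_surj], and the product of
    the three indicators says that it lies in [S]. *)
Lemma trilinear_sum :
  \sum_(i : 'I_n) \sum_(a : 'I_(n ^ al)) \sum_(b : 'I_(n ^ be))
    inside [:: val i] * (inside (digits n al a) * inside (digits n be b) *
                      weight u v H (edge i a b)) =
  \sum_(e : hyperedge n k | val e \subset S) (if e \in H then u else - v).
Proof.
have one (e : hyperedge n k) : \sum_(i : 'I_n) \sum_(a : 'I_(n ^ al))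
    \sum_(b : 'I_(n ^ be)) ((edge i a b == Some e)%:R : R) = 1.
  have [i0 [a0 [b0 e0]]] := edge_surj e.
  have zero i a b : (i, a, b) != (i0, a0, b0) -> edge i a b == Some e = false.
    by move=> ne; apply/negP => /eqP eE; move: ne; rewrite (edge_inj eE e0) eqxx.
  rewrite (bigD1 i0) //= [X in _ + X]big1 ?addr0; last first.
    move=> i ne; rewrite big1 // => a _; rewrite big1 // => b _.
    by rewrite zero // !xpair_eqE (negPf ne).
  rewrite (bigD1 a0) //= [X in _ + X]big1 ?addr0; last first.
    move=> a ne; rewrite big1 // => b _.
    by rewrite zero // !xpair_eqE (negPf ne) andbF.
  rewrite (bigD1 b0) //= [X in _ + X]big1 ?addr0 ?e0 ?eqxx // => b ne.
  by rewrite zero // !xpair_eqE (negPf ne) andbF.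
pose G (e : hyperedge n k) : R := (val e \subset S)%:R * (if e \in H then u else - v).
transitivity (\sum_(i : 'I_n) \sum_(a : 'I_(n ^ al)) \sum_(b : 'I_(n ^ be))
    \sum_e (edge i a b == Some e)%:R * G e).
  apply: eq_bigr => i _; apply: eq_bigr => a _; apply: eq_bigr => b _.
  case eE: (edge i a b) => [e|] /=; last first.
    by rewrite !mulr0 big1 // => e _; rewrite mul0r.
  rewrite (bigD1 e) //= eqxx mul1r big1 ?addr0 => [|e' /negPf ne]; last first.
    by rewrite (_ : Some e == Some e' = false) ?mul0r // -[RHS]ne eq_sym.
  rewrite /G !mulrA; congr (_ * _).
  rewrite -!natrM !mulnb /= andbT -andbA -all_cat.
  have -> : (val e \subset S) = all (mem (map val (enum S))) (digits n k (code i a b)).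
    have [inc <-] := edge_Some eE.
    apply/fintype.subsetP/allP => [sub x|sub x].
      rewrite -enum_digit_set //; last by exact: leq_ltn_trans (leq0n _) (ltn_ord i).
      move=> /mapP[y]; rewrite mem_enum => /sub yS ->.
      by rewrite inE map_f // mem_enum.
    by rewrite mem_digit_set => /sub; rewrite inE (mem_map val_inj) mem_enum.
  by rewrite digits_code.
under eq_bigr => i _ do under eq_bigr => a _ do rewrite exchange_big.
under eq_bigr do rewrite exchange_big.
rewrite exchange_big /= [RHS]big_mkcond; apply: eq_bigr => e _.
under eq_bigr => i _ do under eq_bigr => a _ do rewrite -mulr_suml.
under eq_bigr do rewrite -mulr_suml.
by rewrite -mulr_suml one mul1r /G; case: (val e \subset S); rewrite ?mul1r ?mul0r.
Qed.

(** The sum counts [m]-tuples over [S], which embed into functions from ['I_m] to [S] by reading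
    digits. *)
Lemma sum_inside_le m : \sum_(a : 'I_(n ^ m)) inside (digits n m a) ^+ 2 <= (#|S| ^ m)%:R.
Proof.
have [n0|n0] := posnP n.
  case: m => [|m]; first by rewrite expn0 big_ord1 /inside /= expr1n.
  have z : (n ^ m.+1 = 0)%N by rewrite n0 exp0n.
  by rewrite big1 ?ler0n // => a _; have := ltn_ord a; lia.
pose f (a : 'I_(n ^ m)) : {ffun 'I_m -> 'I_n} :=
  [ffun i : 'I_m => Ordinal (ltn_pmod (a %/ n ^ i) n0)].
have f_inj : injective f.
  move=> a a' /ffunP faa; apply: val_inj => /=.
  rewrite -(digitsK (ltn_ord a)) -(digitsK (ltn_ord a')); congr undigits.
  apply/eq_in_map => i; rewrite mem_iota => /= im.
  by have := faa (Ordinal im); rewrite !ffunE => /(congr1 val).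
have -> : \sum_(a : 'I_(n ^ m)) inside (digits n m a) ^+ 2 =
    (#|[set a : 'I_(n ^ m) | all (mem (map val (enum S))) (digits n m a)]|)%:R.
  rewrite -sum1_card natr_sum [RHS]big_mkcond; apply: eq_bigr => a _.
  by rewrite inE /inside; case: (all _ _); rewrite ?expr1n ?expr0n.
have cardE : (#|S| ^ m = #|[pred g : {ffun 'I_m -> 'I_n} | g \in ffun_on (mem S)]|)%N.
  by rewrite card_ffun_on card_ord.
rewrite ler_nat cardE -(card_imset _ f_inj).
apply: subset_leq_card; apply/fintype.subsetP => _ /imsetP[a + ->].
rewrite inE => /allP ha; apply/ffun_onP => i; rewrite ffunE.
rewrite -mem_enum -(mem_map val_inj) /=; apply: ha.
by apply: map_f; rewrite mem_iota ltn_ord.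
Qed.

Lemma card_hyperedge_sub : #|[set e : hyperedge n k | val e \subset S]| = 'C(#|S|, k).
Proof.
rewrite -(card_imset _ val_inj) -cards_draws; apply: eq_card => T.
rewrite inE; apply/imsetP/andP => [[e]|[TS Tk]].
  by rewrite inE => eS ->; split=> //; exact: (valP e).
by exists (exist _ T Tk); rewrite ?inE.
Qed.

End Independent.
End Edges.

(** * The certifying expression *)

Local Open Scope nat_scope.

Lemma sum_prod (R : nmodType) (I J : finType) (F : I * J -> R) :
  (\sum_p F p = \sum_i \sum_j F (i, j))%R.
Proof. by rewrite pair_bigA; apply: eq_bigr => -[]. Qed.

Definition ELe a b := ESub (ECst 1) (ESub a b).
Definition ELt a b := ELe (EAdd a (ECst 1)) b.
Definition EEq a b := EMul (ELe a b) (ELe b a).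
Definition EXor a b := EAdd (ESub a b) (ESub b a).

Fixpoint EExp (a : expr) (m : nat) : expr :=
  if m is m'.+1 then EMul a (EExp a m') else ECst 1.

(** Above all variables of the algorithm, which are 0 to 13, so that the macros capture none of
    them. *)
Definition scratch := 20.

(** Division by counting: [y / d] is the number of positive multiples of [d] up to [y]. *)
Definition EDiv y d :=
  ESum scratch (EVar y) (ELe (EMul d (EAdd (EVar scratch) (ECst 1))) (EVar y)).

Fixpoint EPath (e : expr) (es : seq expr) : expr :=
  if es is e' :: es' then EMul (ELt e e') (EPath e' es') else ECst 1.

(** This is [base ^ cnt * ini]. The power may exceed [B], whereas [EMul] clips its first factor; so
    the factors [base] are multiplied in one at a time. *)
Definition EScale base cnt ini :=
  EIter scratch cnt ini (EMul base (EArr (ECst 0))) (ECst 0).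

Lemma sub1_leq x y : 1 - (x - y) = (x <= y).
Proof. by case: leqP => h /=; lia. Qed.

(** * Values of the macros *)

Section Macros.
Variables (w : seq nat) (B : nat).
Hypothesis B0 : 0 < B.
Implicit Types (rho A : nat -> nat).

Notation val e rho A := (ev w B e rho A).

Lemma ev_add a b rho A : val (EAdd a b) rho A = val a rho A + val b rho A.
Proof. by []. Qed.

Lemma ev_sub a b rho A : val (ESub a b) rho A = val a rho A - val b rho A.
Proof. by []. Qed.

Lemma ev_var x rho A : val (EVar x) rho A = rho x.
Proof. by []. Qed.

Lemma ev_cst c rho A : val (ECst c) rho A = c.
Proof. by []. Qed.

Lemma ev_arr a rho A : val (EArr a) rho A = A (val a rho A).
Proof. by []. Qed.

Lemma ev_in a rho A : val (EIn a) rho A = nth 0 w (val a rho A).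
Proof. by []. Qed.

Lemma ev_le a b rho A : val (ELe a b) rho A = (val a rho A <= val b rho A).
Proof. exact: sub1_leq. Qed.

Lemma ev_lt a b rho A : val (ELt a b) rho A = (val a rho A < val b rho A).
Proof. by rewrite ev_le /= addn1. Qed.

Lemma ev_mul a b rho A : val a rho A <= B ->
  val (EMul a b) rho A = val a rho A * val b rho A.
Proof. by move=> h /=; rewrite (minn_idPl h). Qed.

Lemma ev_guard a b (c : bool) rho A : val a rho A = c ->
  val (EMul a b) rho A = if c then val b rho A else 0.
Proof. by move=> h /=; rewrite h; case: c {h} => /=; rewrite ?min0n // (minn_idPl _) // mul1n. Qed.

Lemma ev_eq a b rho A : val (EEq a b) rho A = (val a rho A == val b rho A).
Proof.
rewrite /EEq (ev_guard _ (ev_le a b rho A)) ev_le eqn_leq.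
by case: (_ <= _).
Qed.

Lemma ev_xor a b (c d : bool) rho A : val a rho A = c -> val b rho A = d ->
  val (EXor a b) rho A = c (+) d.
Proof. by move=> /= -> ->; case: c; case: d. Qed.

Lemma ev_exp a m rho A : val a rho A <= B -> val (EExp a m) rho A = val a rho A ^ m.
Proof. by move=> h; elim: m => [|m IH] //; rewrite [EExp _ _]/= ev_mul // IH expnS. Qed.

Lemma ev_sum x a b rho A : val a rho A <= B ->
  val (ESum x a b) rho A = \sum_(v < val a rho A) val b (upd rho x v) A.
Proof. by move=> h; rewrite [LHS]/= (minn_idPl h). Qed.

Lemma ev_iter x cnt ini stp idx rho A : val cnt rho A <= B ->
  val (EIter x cnt ini stp idx) rho A =
  iter (val cnt rho A)
    (fun A' r => if r < B then val stp (upd rho x r) A' else 0)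
    (fun r => if r < B then val ini (upd rho x r) A else 0) (val idx rho A).
Proof. by move=> h; rewrite [LHS]/= (minn_idPl h). Qed.

Lemma sum_div y d : 0 < d -> \sum_(v < y) (d * v.+1 <= y : nat) = y %/ d.
Proof.
move=> d0; under eq_bigr do rewrite mulnC -leq_divRL //.
have: y %/ d <= y by exact: leq_div.
move: (y %/ d) => q; rewrite -(big_mkord xpredT (fun v => (v < q : nat))).
elim: y => [|y IH]; first by rewrite leqn0 => /eqP ->; rewrite big_geq.
rewrite leq_eqVlt => /orP[/eqP ->|].
  rewrite (eq_big_nat _ _ (F2 := fun=> 1)); last by move=> i /andP[_ ->].
  by rewrite sum_nat_const_nat muln1 subn0.
by rewrite ltnS => qy; rewrite big_nat_recr //= IH // ltnNge qy addn0.
Qed.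

Lemma ev_div y d v rho A : y != scratch -> rho y <= B -> 0 < v <= B ->
  (forall u, val d (upd rho scratch u) A = v) ->
  val (EDiv y d) rho A = rho y %/ v.
Proof.
move=> ys yB /andP[v0 vB] dE; rewrite /EDiv ev_sum // -sum_div //; apply: eq_bigr => u _.
by rewrite ev_le ev_mul dE //= !updE (negPf ys) eqxx addn1.
Qed.

Lemma ev_path e es rho A :
  val (EPath e es) rho A =
  path ltn (val e rho A) [seq val e' rho A | e' <- es].
Proof.
elim: es e => [|e' es IH] e //=.
rewrite -[LHS]/(val (EMul (ELt e e') (EPath e' es)) rho A).
rewrite (ev_guard _ (ev_lt e e' rho A)) IH.
by case: (_ < _).
Qed.

Lemma ev_scale base cnt ini b rho A : val cnt rho A <= B ->
  (forall A', val base (upd rho scratch 0) A' = b) -> b <= B ->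
  val (EScale base cnt ini) rho A =
  b ^ val cnt rho A * val ini (upd rho scratch 0) A.
Proof.
move=> cB bE bB; rewrite /EScale [LHS]/= (minn_idPl cB).
elim: (val cnt rho A) => [|m IH]; first by rewrite /= B0 mul1n.
by rewrite iterS B0 bE (minn_idPl bB) IH expnS mulnA.
Qed.

End Macros.

Section Algorithm.
Variables (al be : nat).
Let k := 1 + (al + be).

(** Variables: 0 is [n], 1 is [t], 2 is [l] with [L = 2^(l+1)], 3 is [j], 4 is [s];
    (5, 6) is the row where a closed walk starts, 7 an array index, 8 the vertex
    [i], (9, 10) and (11, 12) are rows of the matrix, 13 is a sign.  As registers
    hold naturals, a vector entry is stored as two numbers, its positive part at
    sign 0 and its negative part at sign 1, and it is their difference. *)
Definition EPw m := EExp (EVar 0) m.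
Definition EDigit y m :=
  ESub (EDiv y (EPw m)) (EMul (EVar 0) (EDiv y (EPw m.+1))).
Definition EInc i a b :=
  EPath (EVar i) ([seq EDigit a m | m <- iota 0 al] ++
                  [seq EDigit b m | m <- iota 0 be]).
Definition ECode i a b :=
  EAdd (EVar i) (EMul (EVar 0) (EAdd (EVar a) (EMul (EPw al) (EVar b)))).
Definition ETab i a b := EIn (EAdd (ECode i a b) (ECst 2)).
Definition ENeg i a b := ESub (ECst 1) (ETab i a b).
Definition EAbs i a b :=
  EMul (EInc i a b)
    (EAdd (EMul (ETab i a b) (ESub (EPw k) (EVar 3)))
          (EMul (ENeg i a b) (EVar 3))).
(** The sign is the lowest bit, so the two parts of a vector occupy indices of different parity. *)
Definition EIdx s a b :=
  EAdd s (EMul (ECst 2) (EAdd (EVar a) (EMul (EPw al) (EVar b)))).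

(** One multiplication by the matrix. The guard under the sums over 13, 9 and 10 decodes the array
    index 7 into a sign and a row. Each negative weight flips the part that is read. *)
Definition EStep :=
  ESum 13 (ECst 2) (ESum 9 (EPw al) (ESum 10 (EPw be)
    (EMul (EEq (EVar 7) (EIdx (EVar 13) 9 10))
      (ESum 8 (EVar 0) (ESum 11 (EPw al) (ESum 12 (EPw be)
        (EMul (EAbs 8 9 12) (EMul (EAbs 8 11 10)
          (EArr (EIdx (EXor (EVar 13) (EXor (ENeg 8 9 12) (ENeg 8 11 10)))
                   11 12)))))))))).

Definition ELen := EScale (ECst 2) (EAdd (EVar 2) (ECst 1)) (ECst 1).

(** The iteration starts from the unit vector at row (5, 6) and is read at the same row, which gives
    a diagonal entry of [M^L]; [c] selects its part. *)
Definition EWalk c :=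
  EIter 7 ELen (EEq (EVar 7) (EIdx (ECst 0) 5 6)) EStep (EIdx (ECst c) 5 6).

Definition ETrace c := ESum 5 (EPw al) (ESum 6 (EPw be) (EWalk c)).

Definition EK := EMul (EExp (EVar 4) k) (ECst (k`! ^ 2)).

Definition ER :=
  let e := EMul (EVar 3) (EExp (ESub (EVar 4) (ECst k)) k) in EMul e e.

(** The negative part of the trace is moved to the right side, as registers hold no negative
    numbers. *)
Definition EGood :=
  ELt (EScale EK ELen (ETrace 0))
    (EAdd (EScale EK ELen (ETrace 1)) (EScale ER ELen (ECst 1))).

(** Sums serve as disjunctions. The first term accepts [t = 0] if there is a vertex. The guard
    [L <= n] keeps the iteration counts within [B]. *)
Definition EMain :=
  EAdd (EMul (ELe (EVar 1) (ECst 0)) (EVar 0))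
    (ESum 2 (EVar 0) (ESum 3 (EAdd (EPw k) (ECst 1)) (ESum 4 (EAdd (EVar 0) (ECst 1))
      (EMul (ELe ELen (EVar 0))
        (EMul (ELt (EMul (ESub (EVar 4) (ECst 1)) (EVar 1)) (EVar 0))
          EGood))))).

(** * Values of the certifying expression *)

Section Evaluation.
Arguments ev : simpl never.
Variables (w : seq nat) (B n j : nat) (T : nat -> bool).
Hypothesis B0 : 1 < B.
Hypothesis nB : forall m, m <= k -> n ^ m <= B.
Hypothesis jn : j <= n ^ k.
Hypothesis wT : forall c, c < n ^ k -> nth 0 w c.+2 = T c.
Implicit Types (rho A : nat -> nat).

Notation val e rho A := (ev w B e rho A).

Let B1 : 0 < B. Proof. exact: ltnW. Qed.
Let nB1 : n <= B. Proof. by rewrite -[n]expn1 nB. Qed.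

Definition idx s a b := s + 2 * (a + n ^ al * b).

Definition wabs i a b :=
  if increasing n k (code n al i a b)
  then (if T (code n al i a b) then n ^ k - j else j) else 0.

Lemma ev_pw m rho A : rho 0 = n -> m <= k -> val (EPw m) rho A = n ^ m.
Proof.
move=> r0 mk; have v0 : val (EVar 0) rho A = n by [].
by rewrite /EPw ev_exp ?v0 // -[n]expn1 nB.
Qed.

Lemma ev_digit y m rho A : 0 < n -> y != scratch -> rho 0 = n -> rho y <= B ->
  m < k -> val (EDigit y m) rho A = (rho y %/ n ^ m) %% n.
Proof.
move=> n0 ys r0 yB mk; rewrite /EDigit ev_sub.
rewrite (@ev_div w B y (EPw m) (n ^ m)) //; first last.
- by move=> u; rewrite ev_pw // ltnW.
- by rewrite expn_gt0 n0 nB // ltnW.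
have v0 : val (EVar 0) rho A = n by [].
rewrite ev_mul ?v0 //.
rewrite (@ev_div w B y (EPw m.+1) (n ^ m.+1)) //; first last.
- by move=> u; rewrite ev_pw.
- by rewrite expn_gt0 n0 nB.
by rewrite expnSr divnMA {1}(divn_eq (_ %/ n ^ m) n) mulnC addKn.
Qed.

Lemma ev_code i a b rho A : rho 0 = n ->
  val (ECode i a b) rho A = code n al (rho i) (rho a) (rho b).
Proof.
move=> r0; have alk : al <= k by rewrite /k; lia.
have v0 : val (EVar 0) rho A = n by [].
rewrite /ECode ev_add ev_mul ?v0 // !ev_add !ev_var.
by rewrite ev_mul ?ev_pw // nB.
Qed.

Lemma ev_tab i a b rho A : rho 0 = n -> rho i < n -> rho a < n ^ al ->
  rho b < n ^ be ->
  val (ETab i a b) rho A = T (code n al (rho i) (rho a) (rho b)).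
Proof.
move=> r0 hi ha hb; by rewrite /ETab ev_in ev_add ev_cst ev_code // addn2 wT // code_lt.
Qed.

Lemma ev_neg i a b rho A : rho 0 = n -> rho i < n -> rho a < n ^ al ->
  rho b < n ^ be ->
  val (ENeg i a b) rho A = ~~ T (code n al (rho i) (rho a) (rho b)).
Proof.
move=> r0 hi ha hb; rewrite /ENeg ev_sub ev_cst ev_tab //.
by case: (T _).
Qed.

Lemma ev_inc i a b rho A : a != scratch -> b != scratch ->
  rho 0 = n -> rho i < n -> rho a < n ^ al -> rho b < n ^ be ->
  val (EInc i a b) rho A = increasing n k (code n al (rho i) (rho a) (rho b)).
Proof.
move=> ya yb r0 hi ha hb; rewrite /EInc (ev_path _ B1) /increasing /k (digits_code _ _ hi ha) /=.
have n0 : 0 < n by lia.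
have alk : al <= k by rewrite /k; lia.
have bek : be <= k by rewrite /k; lia.
have aB : rho a <= B by apply: leq_trans (ltnW ha) (nB alk).
have bB : rho b <= B by apply: leq_trans (ltnW hb) (nB bek).
congr (nat_of_bool (path ltn _ _)); rewrite map_cat -!map_comp; congr (_ ++ _).
- apply/eq_in_map => m; rewrite mem_iota => /= ml; rewrite -[LHS]/(val (EDigit a m) rho A).
  by rewrite ev_digit //; rewrite /k; lia.
- apply/eq_in_map => m; rewrite mem_iota => /= ml; rewrite -[LHS]/(val (EDigit b m) rho A).
  by rewrite ev_digit //; rewrite /k; lia.
Qed.

Lemma ev_abs i a b rho A : a != scratch -> b != scratch ->
  rho 0 = n -> rho 3 = j -> rho i < n -> rho a < n ^ al -> rho b < n ^ be ->
  val (EAbs i a b) rho A = wabs (rho i) (rho a) (rho b).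
Proof.
move=> ya yb r0 r3 hi ha hb; rewrite /EAbs (ev_guard B1 _ (ev_inc _ _ _ _ _ _ _)) //.
rewrite /wabs; case: ifP => // _.
rewrite ev_add.
rewrite (ev_guard B1 _ (ev_tab _ _ _ _ _)) // (ev_guard B1 _ (ev_neg _ _ _ _ _)) //.
rewrite ev_sub ev_pw // !ev_var r3.
by case: (T _); rewrite ?addn0.
Qed.

Lemma wabs_le i a b : wabs i a b <= B.
Proof.
have := nB (leqnn k); rewrite /wabs; case: ifP => // _; case: ifP => _; lia.
Qed.

Lemma ev_idx s a b rho A : rho 0 = n ->
  val (EIdx s a b) rho A = idx (val s rho A) (rho a) (rho b).
Proof.
move=> r0; have alk : al <= k by rewrite /k; lia.
rewrite /EIdx ev_add ev_mul // !ev_add !ev_var.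
by rewrite ev_mul ?ev_pw // nB.
Qed.

Lemma idx_inj s a b s' a' b' : s < 2 -> s' < 2 -> a < n ^ al -> a' < n ^ al ->
  idx s a b = idx s' a' b' -> [/\ s = s', a = a' & b = b'].
Proof.
rewrite /idx => hs hs' ha ha' e; have e1 : s = s' by lia.
have e2 : a + n ^ al * b = a' + n ^ al * b' by lia.
have e3 : a = a'.
  by have := congr1 (modn^~ (n ^ al)) e2; rewrite /= ![_ + _ * _]addnC !(mulnC (n ^ al)) !modnMDl !modn_small.
by split=> //; nia.
Qed.

Lemma sum_idx (F : nat -> nat -> nat -> nat) s a b : s < 2 -> a < n ^ al -> b < n ^ be ->
  \sum_(s' < 2) \sum_(a' < n ^ al) \sum_(b' < n ^ be)
    (if idx s a b == idx s' a' b' then F s' a' b' else 0) = F s a b.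
Proof.
move=> hs ha hb.
have off (s' : 'I_2) (a' : 'I_(n ^ al)) (b' : 'I_(n ^ be)) :
    ((s' : nat, a' : nat, b' : nat) != (s, a, b)) ->
    (if idx s a b == idx s' a' b' then F s' a' b' else 0) = 0.
  move=> ne; case: eqP => // /idx_inj h.
  have [//|//|//|//|? ? ?] := h; move: ne; by subst; rewrite eqxx.
rewrite (bigD1 (Ordinal hs)) //= [X in _ + X]big1 ?addn0; last first.
  move=> s' ne; rewrite big1 // => a' _; rewrite big1 // => b' _.
  by apply: off; rewrite !xpair_eqE -val_eqE in ne *; rewrite (negPf ne).
rewrite (bigD1 (Ordinal ha)) //= [X in _ + X]big1 ?addn0; last first.
  move=> a' ne; rewrite big1 // => b' _.
  by apply: (off (Ordinal hs)); rewrite !xpair_eqE -val_eqE /= in ne *; rewrite (negPf ne) andbF.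
rewrite (bigD1 (Ordinal hb)) //= [X in _ + X]big1 ?addn0 ?eqxx // => b' ne.
by apply: (off (Ordinal hs) (Ordinal ha)); rewrite !xpair_eqE -val_eqE /= in ne *; rewrite (negPf ne) andbF.
Qed.

Lemma ev_step (c : bool) a b rho A : rho 0 = n -> rho 3 = j ->
  a < n ^ al -> b < n ^ be -> rho 7 = idx c a b ->
  val EStep rho A =
  \sum_(i < n) \sum_(a' < n ^ al) \sum_(b' < n ^ be)
    wabs i a b' * (wabs i a' b *
      A (idx (c (+) (~~ T (code n al i a b') (+) ~~ T (code n al i a' b))) a' b')).
Proof.
move=> r0 r3 ha hb r7.
have alk : al <= k by rewrite /k; lia.
have bek : be <= k by rewrite /k; lia.
pose F s a b := \sum_(i < n) \sum_(a' < n ^ al) \sum_(b' < n ^ be)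
    wabs i a b' * (wabs i a' b *
      A (idx ((s == 1) (+) (~~ T (code n al i a b') (+) ~~ T (code n al i a' b))) a' b')).
transitivity (F c a b); last first.
  by rewrite /F; apply: eq_bigr => i _; case: (c).
rewrite -(@sum_idx F c a b) //; last by case: (c).
rewrite /EStep ev_sum ev_cst //; apply: eq_bigr => s _.
rewrite ev_sum ev_pw ?nB //; apply: eq_bigr => a1 _.
rewrite ev_sum ev_pw ?nB //; apply: eq_bigr => b1 _.
set rho1 := upd _ 10 _.
have i0 : rho1 0 = n by [].
rewrite (ev_guard B1 _ (ev_eq _ B1 _ _ _ _)) ev_idx // !ev_var.
have s13 : rho1 13 = s by []. have s9 : rho1 9 = a1 by [].
have s10 : rho1 10 = b1 by []. have s7 : rho1 7 = idx c a b by [].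
rewrite s13 s9 s10 s7; case: ifP => // _.
rewrite ev_sum ev_var ?i0 //; apply: eq_bigr => i _.
rewrite ev_sum ev_pw ?nB //; apply: eq_bigr => a' _.
rewrite ev_sum ev_pw ?nB //; apply: eq_bigr => b' _.
set rho2 := upd _ 12 _.
have e8 : rho2 8 = i by []. have e9 : rho2 9 = a1 by [].
have e10 : rho2 10 = b1 by []. have e11 : rho2 11 = a' by [].
have e12 : rho2 12 = b' by []. have e0 : rho2 0 = n by [].
have e3 : rho2 3 = j by []. have e13 : rho2 13 = s by [].
have E1 : val (EAbs 8 9 12) rho2 A = wabs i a1 b'.
  by rewrite ev_abs ?e8 ?e9 ?e12.
have E2 : val (EAbs 8 11 10) rho2 A = wabs i a' b1.
  by rewrite ev_abs ?e8 ?e11 ?e10.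
rewrite ev_mul E1 ?wabs_le // ev_mul E2 ?wabs_le // ev_arr ev_idx // e11 e12.
have N1 : val (ENeg 8 9 12) rho2 A = ~~ T (code n al i a1 b').
  by rewrite ev_neg ?e8 ?e9 ?e12.
have N2 : val (ENeg 8 11 10) rho2 A = ~~ T (code n al i a' b1).
  by rewrite ev_neg ?e8 ?e11 ?e10.
have S1 : val (EVar 13) rho2 A = (s == 1 :> nat).
  by rewrite ev_var e13; case: s {e13 s13 s9 s10 s7 rho1 i0 rho2 e8 e9 e10 e11 e12 e0 e3 E1 E2 N1 N2} => -[|[|]].
by rewrite (ev_xor S1 (ev_xor N1 N2)).
Qed.

Hypothesis B_idx : 2 * n ^ (al + be) <= B.

Lemma ev_len l rho A : rho 2 = l -> l.+1 <= B -> val ELen rho A = 2 ^ l.+1.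
Proof.
move=> r2 lB; have cE : val (EAdd (EVar 2) (ECst 1)) rho A = l.+1.
  by rewrite ev_add ev_var ev_cst r2 addn1.
by rewrite /ELen (@ev_scale _ _ B1 _ _ _ 2) ?cE // ev_cst muln1.
Qed.

Lemma idx_lt s a b : s < 2 -> a < n ^ al -> b < n ^ be -> idx s a b < B.
Proof. by move=> hs ha hb; apply: leq_trans B_idx; rewrite expnD /idx; nia. Qed.

Section Signed.
Local Open Scope ring_scope.
Variables (R : realFieldType) (H : hypergraph n k).
Hypothesis TH : forall c, T c = (digit_set n k c \in [set \val e | e in H]).

Let u : R := (n ^ k - j)%N%:R.
Let v : R := j%:R.
Let M := walk (@edge n al be) u v H.

Lemma weight_sign (i : 'I_n) (a : 'I_(n ^ al)) (b : 'I_(n ^ be)) :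
  weight u v H (edge i a b) = (-1) ^+ (~~ T (code n al i a b)) * (wabs i a b)%:R.
Proof.
rewrite /wabs TH; case eE: (edge i a b) => [e|] /=.
  rewrite (mem_edge _ eE); have [-> _] := edge_Some eE.
  by case: (e \in H); rewrite ?mul1r ?mulN1r.
by rewrite (negPf (edge_None eE)) mulr0.
Qed.

Section Vector.
Variables (rho A : nat -> nat) (a0 : 'I_(n ^ al)) (b0 : 'I_(n ^ be)).
Hypotheses (r0 : rho 0%N = n) (r3 : rho 3 = j) (r5 : rho 5 = a0) (r6 : rho 6 = b0).

Let vec L : nat -> nat :=
  iter L (fun A' r => if (r < B)%N then val EStep (upd rho 7 r) A' else 0%N)
    (fun r => if (r < B)%N then val (EEq (EVar 7) (EIdx (ECst 0) 5 6)) (upd rho 7 r) A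
              else 0%N).

(** A product of two weights has exactly the sign by which [EStep] swaps the parts, so taking the
    difference of the parts commutes with a step. *)
Lemma vec_mpow L (a : 'I_(n ^ al)) (b : 'I_(n ^ be)) :
  (vec L (idx false a b))%:R - (vec L (idx true a b))%:R = mpow M L (a, b) (a0, b0).
Proof.
elim: L a b => [|L IH] a b.
  rewrite /vec /= !idx_lt // !(ev_eq _ B1) !ev_var !ev_idx // !ev_cst /= !updE /= r5 r6.
  (* Cells of sign 1 start at 0: their indices are odd, and the unit sits at an even one. *)
  rewrite [idx true a b == _](_ : _ = false); last first.
    by apply/negP => /eqP /(congr1 odd); rewrite /idx !oddD !oddM /= !addbF !addbb.
  rewrite subr0 xpair_eqE -!val_eqE; congr (nat_of_bool _)%:R.
  apply/eqP/andP => [/idx_inj h|[/eqP -> /eqP ->] //].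
  by have [//|//|//|//|_ ea eb] := h; rewrite /= ea eb !eqxx.
rewrite /vec !iterS -/(vec L) !idx_lt //.
rewrite (@ev_step false a b) ?(@ev_step true a b) //.
rewrite !natr_sum -sumrB [RHS]/= sum_prod.
under [RHS]eq_bigr => a' _ do under eq_bigr => b' _ do rewrite /M /walk mulr_suml.
under [RHS]eq_bigr => a' _ do rewrite exchange_big.
rewrite [RHS]exchange_big; apply: eq_bigr => i _.
rewrite !natr_sum -sumrB; apply: eq_bigr => a' _.
rewrite !natr_sum -sumrB; apply: eq_bigr => b' _ /=.
rewrite -IH !weight_sign !natrM.
by case: (T _); case: (T _); rewrite /= ?expr0 ?expr1; ring.
Qed.

Lemma ev_walk (c : bool) l : rho 2 = l -> (l.+1 <= B)%N -> (2 ^ l.+1 <= B)%N ->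
  val (EWalk c) rho A = vec (2 ^ l.+1) (idx c a0 b0).
Proof.
move=> r2 lB LB.
have -> : idx c a0 b0 = val (EIdx (ECst c) 5 6) rho A.
  by rewrite ev_idx // ev_cst r5 r6.
by rewrite /EWalk ev_iter !(ev_len A r2).
Qed.

End Vector.

Definition trace L := \sum_r mpow M L r r.

Lemma ev_trace rho A l : rho 0%N = n -> rho 3 = j -> rho 2 = l ->
  (l.+1 <= B)%N -> (2 ^ l.+1 <= B)%N ->
  (val (ETrace 0) rho A)%:R - (val (ETrace 1) rho A)%:R = trace (2 ^ l.+1).
Proof.
move=> r0 r3 r2 lB LB; have alk : (al <= k)%N by rewrite /k; lia.
have bek : (be <= k)%N by rewrite /k; lia.
rewrite /trace sum_prod.
rewrite !ev_sum ?ev_pw ?nB // !natr_sum -sumrB; apply: eq_bigr => a _.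
rewrite !ev_sum ?ev_pw ?nB // !natr_sum -sumrB; apply: eq_bigr => b _.
set rho1 := upd _ 6 _.
have e5 : rho1 5 = a by []. have e6 : rho1 6 = b by [].
have e0 : rho1 0%N = n by []. have e3 : rho1 3 = j by [].
have e2 : rho1 2 = l by [].
rewrite -(@vec_mpow rho1 A a b e0 e3 e5 e6).
by rewrite -(@ev_walk rho1 A a b e0 e5 e6 false l) // -(@ev_walk rho1 A a b e0 e5 e6 true l).
Qed.

Hypothesis B_K : forall s, (s <= n)%N -> (s ^ k * k`! ^ 2 <= B)%N.
Hypothesis B_R : forall s, (s <= n)%N -> ((j * (s - k) ^ k) ^ 2 <= B)%N.

(** With denominators cleared, this is [tr(M^L) s^(k L) < (j C(s, k))^(2 L)] where [C(s, k)] is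
    replaced by its lower bound [(s - k)^k / k!]. *)
Definition good l s :=
  trace (2 ^ l.+1) * (k`! ^ 2 * s ^ k)%:R ^+ (2 ^ l.+1) <
  ((j * (s - k) ^ k) ^ 2)%:R ^+ (2 ^ l.+1).

Lemma ev_good rho A l s : rho 0%N = n -> rho 3 = j -> rho 2 = l -> rho 4 = s ->
  (s <= n)%N -> (l.+1 <= B)%N -> (2 ^ l.+1 <= B)%N ->
  val EGood rho A = good l s.
Proof.
move=> r0 r3 r2 r4 sn lB LB; rewrite /EGood ev_lt ev_add.
have sB : (s <= B)%N by exact: leq_trans nB1.
have jB : (j <= B)%N by exact: leq_trans jn (nB (leqnn k)).
have kE A' : val EK (upd rho scratch 0) A' = (s ^ k * k`! ^ 2)%N.
  have e4 : val (EVar 4) (upd rho scratch 0) A' = s by [].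
  have eE : val (EExp (EVar 4) k) (upd rho scratch 0) A' = (s ^ k)%N.
    by rewrite ev_exp e4.
  rewrite /EK ev_mul eE ?ev_cst //.
  by apply: leq_trans (B_K sn); rewrite leq_pmulr // expn_gt0 fact_gt0.
have RE A' : val ER (upd rho scratch 0) A' = ((j * (s - k) ^ k) ^ 2)%N.
  rewrite /ER /=; set e := EMul (EVar 3) _.
  have e3 : val (EVar 3) (upd rho scratch 0) A' = j by [].
  have e4 : val (ESub (EVar 4) (ECst k)) (upd rho scratch 0) A' = (s - k)%N.
    by rewrite ev_sub ev_var ev_cst /= updE /= r4.
  have eE : val e (upd rho scratch 0) A' = (j * (s - k) ^ k)%N.
    have p4 : val (EExp (ESub (EVar 4) (ECst k)) k) (upd rho scratch 0) A' = ((s - k) ^ k)%N.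
      by rewrite ev_exp e4 //; apply: leq_trans (leq_subr _ _) sB.
    by rewrite /e ev_mul e3 ?p4.
  (* A natural number is at most its square, which [B_R] bounds. *)
  rewrite ev_mul eE ?mulnn //; apply: leq_trans (B_R sn).
  by case: (j * _)%N => // m; rewrite leq_pmull.
have LE : val ELen rho A = (2 ^ l.+1)%N by rewrite (ev_len A r2).
rewrite !(@ev_scale _ _ B1 EK ELen _ _ _ _ _ kE) ?LE ?B_K //.
rewrite (@ev_scale _ _ B1 ER ELen _ _ _ _ _ RE) ?LE ?B_R // ev_cst muln1.
set rho1 := upd _ _ _.
have tr := @ev_trace rho1 A l r0 r3 r2 lB LB.
rewrite /good -tr [(k`! ^ 2 * _)%N]mulnC.
move: (s ^ k * _)%N ((j * _) ^ 2)%N (2 ^ l.+1)%N => K S L.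
rewrite -(ltr_nat R) natrD !natrM !natrX mulrBl ltrBlDr [S%:R ^+ _ + _]addrC.
by rewrite ![K%:R ^+ _ * _]mulrC.
Qed.

End Signed.
End Evaluation.
End Algorithm.

Lemma sum_nat_neq0 m (F : 'I_m -> nat) :
  reflect (exists i, F i != 0) (\sum_i F i != 0).
Proof.
rewrite sum_nat_eq0 negb_forall; apply: (iffP existsP) => -[i]; first by exists i.
by move=> Fi; exists i.
Qed.

(** * What the certifying expression decides *)

Section Specification.
Variables (al be : nat).
Let k := 1 + (al + be).
Let c := k`! ^ 2 + 2.
Let D := (4 * k).+1.

(** The exponent [4 * k] is that of the square of [j (s - k)^k] for [j <= n^k]. The constant [c] has
    room for the factor [k!^2] in [B_K] and for the factor 2 in array indices. *)
Lemma fuel_ge n m : m <= 4 * k -> c * n ^ m <= (c + n) ^ D.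
Proof.
move=> mk; rewrite expnS leq_mul ?leq_addr //.
apply: leq_trans (_ : (c + n) ^ m <= _); last by rewrite leq_pexp2l // /c addn2.
by case: m mk => // m _; rewrite leq_exp2r // leq_addl.
Qed.

Lemma encode_size (x : instance k) :
  nth 0 (encode x) 0 < size (encode x) <= (c + nth 0 (encode x) 0) ^ D.
Proof.
case: x => n H t; rewrite /= size_map size_iota; apply/andP; split.
  have h : n <= n ^ k by case: (n) => // m; rewrite -{1}[m.+1]expn1 leq_pexp2l.
  by rewrite ltnS ltnW.
have := @fuel_ge n k; have := @fuel_ge n 0; rewrite expn0 /c.
have := fact_gt0 k; move: (_ ^ D) (n ^ k) => x y; nia.
Qed.

Lemma certify_spec (R : realFieldType) n (H : hypergraph n k) t :
  eval_expr (encode (Instance H t)) c D (EMain al be) != 0 <->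
  (t = 0 /\ 0 < n) \/
  exists l j s, [/\ 2 ^ l.+1 <= n, j <= n ^ k, s <= n, (s - 1) * t < n
                  & @good al be n j R H l s].
Proof.
rewrite /eval_expr [nth 0 _ 0]/=; set w := encode _; set B := (c + n) ^ D.
have cB m : m <= 4 * k -> c * n ^ m <= B by exact: fuel_ge.
have c3 : 2 < c by rewrite /c; have := fact_gt0 k; nia.
have k1 : 0 < k by [].
have B2 : 1 < B by have := @cB 0 isT; rewrite expn0; lia.
have nB m : m <= k -> n ^ m <= B.
  by move=> mk; apply: leq_trans (@cB m _); rewrite ?leq_pmull //; lia.
have nB1 : n.+1 <= B by have := @cB 1; rewrite expn1 => /(_ isT); case: (n) => // m; nia.
have B_idx : 2 * n ^ (al + be) <= B.
  have h : al + be <= 4 * k by rewrite /k; lia.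
  by apply: leq_trans (cB _ h); rewrite leq_mul2r; lia.
have wB : (n ^ k).+1 <= B.
  have h : k <= 4 * k by lia.
  by have := cB _ h; case: (n ^ k) => [|m]; nia.
have B_K s : s <= n -> s ^ k * k`! ^ 2 <= B.
  move=> sn; have h : k <= 4 * k by lia.
  by apply: leq_trans (cB _ h); rewrite mulnC leq_mul ?leq_exp2r // /c leq_addr.
have B_R j s : j <= n ^ k -> s <= n -> (j * (s - k) ^ k) ^ 2 <= B.
  move=> jn sn; have h : 4 * k <= 4 * k by [].
  apply: leq_trans (cB _ h).
  have -> : n ^ (4 * k) = (n ^ k * n ^ k) ^ 2.
    by rewrite -expnD -expnM; congr (_ ^ _); lia.
  apply: leq_trans (leq_pmull _ (ltnW (ltnW c3))).
  rewrite leq_exp2r // leq_mul // leq_exp2r //; lia.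
pose T := fun d => digit_set n k d \in [set \val e | e in H].
have wT d : d < n ^ k -> nth 0 w d.+2 = T d by move=> hd; rewrite nth_encode.
have TH d : T d = (digit_set n k d \in [set \val e | e in H]) by [].
set rho := initial_env w.
rewrite /EMain ev_add (ev_guard (ltnW B2) _ (ev_le _ _ _ _ _ _)) !ev_var ev_cst.
have -> : rho 1 = t by [].
have -> : rho 0 = n by [].
rewrite addn_eq0 negb_and ev_sum ev_var; last by apply: ltnW.
rewrite -[rho 0]/n.
pose body l j s := ev w B (EMul (ELe ELen (EVar 0))
  (EMul (ELt (EMul (ESub (EVar 4) (ECst 1)) (EVar 1)) (EVar 0)) (EGood al be)))
  (upd (upd (upd rho 2 l) 3 j) 4 s) (fun=> 0).
have bodyE l j s : l < n -> j <= n ^ k -> s <= n ->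
  (body l j s != 0) <-> [/\ 2 ^ l.+1 <= n, (s - 1) * t < n & @good al be n j R H l s].
  move=> ln jn sn; rewrite /body; set rho' := upd _ 4 _.
  have e2 : rho' 2 = l by []. have e0 : rho' 0 = n by [].
  have e3 : rho' 3 = j by []. have e4 : rho' 4 = s by [].
  have lB : l.+1 <= B by lia.
  rewrite (ev_guard (ltnW B2) _ (ev_le _ _ _ _ _ _)) (ev_len _ B2 _ e2 lB) ev_var e0.
  case: ifP => hl; last by split=> // -[].
  rewrite (ev_guard (ltnW B2) _ (ev_lt _ _ _ _ _ _)) ev_var e0.
  rewrite ev_mul ev_sub ev_var ev_cst e4; last by lia.
  rewrite ev_var -[rho' 1]/t; case: ifP => ht; last by split=> // -[].
  have -> := ev_good B2 nB jn wT B_idx R TH B_K (fun s => @B_R j s jn)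
    (fun=> 0) e0 e3 e2 e4 sn lB (leq_trans hl (ltnW nB1)).
  by case: (good _ _ _ _); split=> // -[].
have inner l : l < n -> ev w B (ESum 3 (EAdd (EPw k) (ECst 1)) (ESum 4
    (EAdd (EVar 0) (ECst 1)) (EMul (ELe ELen (EVar 0))
  (EMul (ELt (EMul (ESub (EVar 4) (ECst 1)) (EVar 1)) (EVar 0)) (EGood al be)))))
    (upd rho 2 l) (fun=> 0) = \sum_(j < (n ^ k).+1) \sum_(s < n.+1) body l j s.
  move=> ln; have e0 : upd rho 2 l 0 = n by [].
  have jE : ev w B (EAdd (EPw k) (ECst 1)) (upd rho 2 l) (fun=> 0) = (n ^ k).+1.
    by rewrite ev_add ev_cst (ev_pw _ nB _ e0) // addn1.
  rewrite ev_sum jE //; apply: eq_bigr => j _.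
  have sE : ev w B (EAdd (EVar 0) (ECst 1)) (upd (upd rho 2 l) 3 j) (fun=> 0) = n.+1.
    by rewrite ev_add ev_cst ev_var addn1.
  by rewrite ev_sum sE.
rewrite (eq_bigr (fun l : 'I_n => \sum_(j < (n ^ k).+1) \sum_(s < n.+1) body l j s));
  last by move=> l _; exact: inner.
split=> [/orP[]|].
- by case: ifP => //; rewrite leqn0 => /eqP t0 n0; left; rewrite lt0n.
- move=> /sum_nat_neq0[l] /sum_nat_neq0[j] /sum_nat_neq0[s].
  have [jn sn] : j <= n ^ k /\ s <= n by split; rewrite -ltnS.
  move=> /(bodyE _ _ _ (ltn_ord l) jn sn)[h1 h2 h3].
  by right; exists l, j, s.
- move=> [[-> n0]|[l [j [s [hl jn sn hs hg]]]]]; first by rewrite leqnn -lt0n n0.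
  (* The search over [l < n] misses nothing, as [l < 2 ^ l.+1 <= n]. *)
  apply/orP; right; have ln : l < n.
    by apply: leq_trans hl; apply: ltn_trans (ltnSn l) (ltn_expl _ _).
  apply/sum_nat_neq0; exists (Ordinal ln); apply/sum_nat_neq0.
  rewrite -ltnS in jn; exists (Ordinal jn); apply/sum_nat_neq0.
  rewrite -ltnS in sn; exists (Ordinal sn); apply/bodyE => //.
Qed.

End Specification.

(** * Soundness and completeness *)

Local Open Scope ring_scope.

(** All factors of [s ^_ m] are at least [s - k]. At [m = k] this bounds [k! C(s, k)] below by a
    number that is computed without binomials. *)
Lemma subn_exp_le_ffact (s k m : nat) : (m <= k)%N -> ((s - k) ^ m <= s ^_ m)%N.
Proof.
elim: m => [|m IH] mk; first by rewrite expn0 ffactn0.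
rewrite expnSr ffactnSr leq_mul ?IH //; first exact: ltnW.
by rewrite leq_sub2l // ltnW.
Qed.

(** * Soundness of the certificate *)

Section Soundness.
Variables (al be n j : nat) (R : realFieldType).
Let k := (1 + (al + be))%N.
Variable (H : hypergraph n k).
Hypothesis jn : (j <= n ^ k)%N.

(** Without a hyperedge in [S] all weights inside are [- j], and the trilinear form at the indicator
    of [S] is [- j C(s, k)]. Its even powers are bounded through the trace, against [good]. *)
Lemma good_no_independent_set l s (S : {set 'I_n}) : good j R H l s -> #|S| = s ->
  exists2 e, e \in H & val e \subset S.
Proof.
move=> g Ss; apply/exists_inP; apply: contraTT g; rewrite negb_exists_in => /forall_inP ind.
rewrite /good -leNgt /trace.
set u := (n ^ k - j)%N%:R; set L := (2 ^ l.+1)%N; set tr := \sum_r _.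
have tri := trilinear_sum u j%:R H S.
have {tri} : \sum_(i < n) \sum_(a < n ^ al) \sum_(b < n ^ be)
    inside R S [:: val i] * (inside R S (digits n al a) * inside R S (digits n be b) *
                      weight u j%:R H (edge i a b)) = - (j * 'C(s, k))%:R.
  rewrite tri (eq_bigr (fun=> - j%:R)); last first.
    move=> e eS; rewrite ifF //; apply/negP => /ind; by rewrite eS.
  rewrite sumr_const mulNrn -[_ *+ _]mulr_natr -natrM -Ss -card_hyperedge_sub.
  by congr (- (_ * _)%:R); apply: eq_card => e; rewrite inE.
have := trilinear_pow_le_trace (@edge n al be) u j%:R H
  (fun i => inside R S [:: val i]) (fun a => inside R S (digits n al a))
  (fun b => inside R S (digits n be b)) l.
rewrite -/L -/tr => + eq; rewrite eq {eq} exprM sqrrN => le1.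
have tr0 : 0 <= tr by exact: trace_walk_ge0.
have le2 : ((j * 'C(s, k))%:R ^+ 2) ^+ L <= (s ^ k)%:R ^+ L * tr.
  apply: le_trans le1 _; apply: ler_wpM2r => //.
  have pos (J : finType) (F : J -> R) : 0 <= \sum_i F i ^+ 2.
    by apply: sumr_ge0 => i _; exact: sqr_ge0.
  rewrite lerXn2r ?nnegrE ?ler0n ?mulr_ge0 ?pos //.
  rewrite /k expnD expn1 expnD !natrM mulrA -Ss.
  apply: ler_pM; rewrite ?mulr_ge0 ?pos ?sum_inside_le //.
  apply: ler_pM; rewrite ?pos ?sum_inside_le //.
  rewrite -sum1_card natr_sum [leRHS]big_mkcond; apply: ler_sum => i _.
  rewrite /inside /= andbT mem_map ?mem_enum; last exact: val_inj.
  by case: (i \in S); rewrite ?expr1n ?expr0n.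
have le3 : ((j * (s - k) ^ k) ^ 2)%:R <= (k`! ^ 2)%:R * (j * 'C(s, k))%:R ^+ 2 :> R.
  rewrite -natrX -natrM ler_nat -expnMn leq_sqr mulnCA leq_mul2l; apply/orP; right.
  by rewrite mulnC bin_ffact subn_exp_le_ffact.
apply: le_trans (_ : ((k`! ^ 2)%:R * (j * 'C(s, k))%:R ^+ 2) ^+ L <= _).
  by rewrite lerXn2r ?nnegrE ?ler0n ?mulr_ge0 ?sqr_ge0.
rewrite [(k`! ^ 2 * s ^ k)%:R]natrM exprMn [X in _ <= _ * X]exprMn mulrCA.
by rewrite ler_wpM2l ?exprn_ge0 ?ler0n // mulrC.
Qed.

(** Pigeonhole: [q <= t] classes of at most [s - 1] vertices cover at most [(s - 1) t < n] vertices,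
    so some class has [s] vertices and thus contains a hyperedge. *)
Lemma good_not_colorable l s t q : good j R H l s -> ((s - 1) * t < n)%N ->
  colorable H q -> (t < q)%N.
Proof.
move=> g st /existsP[f /forallP col]; rewrite ltnNge; apply/negP => qt.
have [i] : exists i, (s <= #|f @^-1: [set i]|)%N.
  apply/existsP; rewrite -[[exists i, _]]negbK negb_exists; apply/negP => /forallP small.
  (* Otherwise [s - 1] would be truncated. The certificate for [s = 0] would put a hyperedge inside
     the empty set. *)
  have s0 : (0 < s)%N.
    case: s g {st small} => // g; have [e _] := @good_no_independent_set l 0 finset.set0 g (cards0 _).
    by rewrite finset.subset0 => /eqP e0; have := eqP (valP e); rewrite e0 cards0.
  suff : (n <= q * (s - 1))%N.
    move=> nq; have : (n <= (s - 1) * t)%N.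
      by apply: leq_trans nq _; rewrite mulnC leq_mul2l qt orbT.
    by rewrite leqNgt st.
  rewrite -{1}(card_ord n) -sum1_card (partition_big f xpredT) //=.
  have -> : (q * (s - 1) = \sum_(i < q) (s - 1))%N by rewrite sum_nat_const card_ord.
  apply: leq_sum => i _.
  rewrite sum1_card; have := small i; rewrite -ltnNge => lt_s.
  have -> : #|[pred x | f x == i]| = #|f @^-1: [set i]|.
    by apply: eq_card => x; rewrite !inE.
  lia.
(* The class may be larger, but the certificate speaks of sets of size exactly [s], so [s] elements
   are picked. *)
move=> /card_geqP[r [ur sr sub]].
have cr : #|[set:: r]| = s by rewrite cardsE; exact: etrans (card_uniqP ur) sr.
have [e eH eS] := good_no_independent_set g cr.
have /forall_inP /(_ _ eH) /negP := col i; apply.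
apply: fintype.subset_trans eS _; apply/fintype.subsetP => x.
by rewrite inE => /sub.
Qed.

End Soundness.

(** Markov's inequality, meant for a multiple of the trace, which is nonnegative as [L] is even. *)
Lemma hypergraph_prob_markov (R : realType) n k (p c : R) (E : pred (hypergraph n k))
    (F : hypergraph n k -> R) : 0 <= p <= 1 -> (forall H, 0 <= F H) ->
  (forall H, ~~ E H -> c <= F H) ->
  c * (1 - hypergraph_prob p E) <= expect p F.
Proof.
move=> /andP[p0 p1] F0 Ec.
have pmf0 H : 0 <= hypergraph_pmf p H.
  by apply: prodr_ge0 => e _; case: ifP => _ //; rewrite subr_ge0.
have -> : 1 - hypergraph_prob p E = \sum_(H | ~~ E H) hypergraph_pmf p H.
  rewrite -(hypergraph_prob_total n k p) /hypergraph_prob (bigID E) /=.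
  by rewrite addrAC subrr add0r.
rewrite mulr_sumr [leLHS]big_mkcond /expect; apply: ler_sum => H _.
rewrite -/(hypergraph_pmf p H); case: ifP => EH; last by rewrite mulr_ge0.
by rewrite mulrC ler_wpM2l // Ec.
Qed.

Lemma hypergraph_prob_le1 (R : realType) n k (p : R) (E : pred (hypergraph n k)) :
  0 <= p <= 1 -> hypergraph_prob p E <= 1.
Proof.
move=> /andP[p0 p1]; rewrite -(hypergraph_prob_total n k p) /hypergraph_prob.
rewrite [leRHS](bigID E) /= lerDl; apply: sumr_ge0 => H _.
by apply: prodr_ge0 => e _; case: ifP => _ //; rewrite subr_ge0.
Qed.

(** * Success probability of the certificate *)

Section Completeness.
Variables (al be n j : nat) (R : realType).
Let k := (1 + (al + be))%N.
Hypothesis al_le : (al.*2 <= k)%N.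
Hypothesis be_le : (be.*2 <= k)%N.
Hypothesis k_gt1 : (1 < k)%N.
Variables (p sq : R).
Hypothesis p01 : 0 <= p <= 1.
Let W : R := (n ^ k)%:R.
Hypothesis sqE : sq ^+ 2 = W.
Hypothesis sq0 : 0 < sq.
Hypothesis jp : j%:R <= p * W < j%:R + 1.
Hypothesis X1 : 1 <= 2 * p * sq.

Let Z (L : nat) : R := W ^+ 2 * (2 * p * sq) * (L.*2%:R + 2) ^+ 2.

(** Here [sq] is [n^(k/2)]. The charges solve [x * y = 2 * p * W ^+ 2] and [x * sq = y], and [X1]
    gives [y >= W], which the higher moments require. *)
Let X := 2 * p * sq.
Let y := W * Num.sqrt X.
Let x := sq * Num.sqrt X.

Let X0 : 0 <= X. Proof. exact: le_trans ler01 X1. Qed.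
Let rX1 : 1 <= Num.sqrt X. Proof. by rewrite -[leLHS]sqrtr1 ler_sqrt. Qed.
Let W0 : 0 <= W. Proof. exact: ler0n. Qed.
Let n0 : (0 < n)%N.
Proof.
rewrite lt0n; apply/eqP => n0; move: sqE; rewrite /W n0 exp0n // => /eqP.
by rewrite sqrf_eq0 => /eqP s0; move: sq0; rewrite s0 ltxx.
Qed.
Let sq1 : 1 <= sq.
Proof.
have W1 : 1 <= W by rewrite ler1n expn_gt0 n0.
by move: sqE sq0; rewrite expr2 => e ?; nra.
Qed.
Let pow_le_sq m : (m.*2 <= k)%N -> (n ^ m)%:R <= sq.
Proof.
move=> mk; rewrite -(@ler_pXn2r _ 2) ?nnegrE ?(ltW sq0) //= sqE -natrX.
by rewrite ler_nat -expnM muln2 leq_pexp2l.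
Qed.
Let jn : (j <= n ^ k)%N.
Proof.
have /andP[p0 p1] := p01; have /andP[j1 _] := jp.
by rewrite -(ler_nat R); apply: le_trans j1 _; rewrite ler_piMl.
Qed.

Lemma failure_bound l s :
  ((j * (s - k) ^ k) ^ 2)%:R ^+ (2 ^ l.+1) *
    (1 - hypergraph_prob p (fun H : hypergraph n k => good j R H l s)) <=
  (n ^ k.-1)%:R * (Z (2 ^ l.+1) * (k`! ^ 2 * s ^ k)%:R) ^+ (2 ^ l.+1).
Proof.
set L := (2 ^ l.+1)%N; set K := (k`! ^ 2 * s ^ k)%N.
have /andP[p0 p1] := p01; have /andP[j1 j2] := jp.
pose tr (H : hypergraph n k) := @trace al be n j R H L.
have tr0 H : 0 <= tr H by exact: trace_walk_ge0.
apply: le_trans (_ : expect p (fun H => tr H * K%:R ^+ L) <= _).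
  apply: hypergraph_prob_markov => // H.
    by rewrite mulr_ge0 // exprn_ge0.
  by rewrite /good -leNgt.
have -> : expect p (fun H => tr H * K%:R ^+ L) =
    expect p (fun H => tr H) * K%:R ^+ L.
  by rewrite /expect mulr_suml; apply: eq_bigr => H _; rewrite mulrA.
rewrite exprMn mulrA ler_wpM2r ?exprn_ge0 //.
rewrite /tr /trace expect_sum.
have x0 : 0 <= x by rewrite mulr_ge0 ?sqrtr_ge0 ?ltW.
have y0 : 0 <= y by rewrite mulr_ge0 ?sqrtr_ge0.
have xsq : x * sq = y by rewrite /x /y -sqE; ring.
have xle c : (c%:R <= sq) -> x * c%:R <= y by move=> h; rewrite -xsq ler_wpM2l.
have rX : Num.sqrt X ^+ 2 = X by rewrite sqr_sqrtr.
have u_E : (n ^ k - j)%N%:R = W - j%:R :> R by rewrite natrB.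
have W1 : 1 <= W by rewrite -sqE exprn_ege1.
have moment m : `|p * (n ^ k - j)%N%:R ^+ m.+1 + (1 - p) * (- j%:R) ^+ m.+1|
    <= x * y ^+ m.
  (* The mean weight [p W - j] is at most 1 in absolute value, as [j] is the integer part of [p W],
     and [x >= 1]. *)
  case: m => [|m].
    rewrite !expr1 expr0 mulr1 u_E.
    have -> : p * (W - j%:R) + (1 - p) * - j%:R = p * W - j%:R by ring.
    apply: le_trans (_ : 1 <= _).
      by rewrite ler_norml; apply/andP; split; lra.
    by rewrite /x -[leLHS]mulr1 ler_pM.
  apply: le_trans (ler_normD _ _) _.
  rewrite [`|p * _|]normrM [`|(1 - p) * _|]normrM !normrX normrN !normr_nat (ger0_norm p0) ger0_norm ?subr_ge0 //.
  apply: (@le_trans _ _ (p * W ^+ m.+2 + (p * W) ^+ m.+2)).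
    apply: lerD.
      by rewrite ler_wpM2l // lerXn2r ?nnegrE // u_E gerBl.
    apply: le_trans (_ : j%:R ^+ m.+2 <= _).
      by rewrite ler_piMl ?exprn_ge0 // gerBl.
    by rewrite lerXn2r ?nnegrE ?mulr_ge0.
  apply: (@le_trans _ _ (2 * p * W ^+ m.+2)).
    rewrite exprMn; have : p ^+ m.+2 <= p by rewrite exprS ler_piMr // exprn_ile1.
    move=> /(ler_wpM2r (exprn_ge0 m.+2 W0)); lra.
  (* The product [x * y] accounts for [2 * p * W ^+ 2], and every further [y] for one more [W]. *)
  have -> : x * y ^+ m.+1 = 2 * p * W ^+ m.+2 * Num.sqrt X ^+ m.
    rewrite exprS mulrA {1}/y /x.
    have -> : sq * Num.sqrt X * (W * Num.sqrt X) = 2 * p * W ^+ 2.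
      have -> : sq * Num.sqrt X * (W * Num.sqrt X) = sq * W * Num.sqrt X ^+ 2 by ring.
      by rewrite rX /X -sqE; ring.
    by rewrite [y ^+ m]exprMn [W ^+ m.+2]exprS [W ^+ m.+1]exprS expr2 !mulrA.
  apply: ler_peMr; last exact: exprn_ege1.
  by rewrite mulr_ge0 ?exprn_ge0 // mulr_ge0.
have Zge0 : 0 <= y ^+ 2 * (L.*2%:R + 2) ^+ 2 by rewrite mulr_ge0 ?sqr_ge0.
have ZE : Z L = y ^+ 2 * (L.*2%:R + 2) ^+ 2 by rewrite /Z /y exprMn rX.
apply: (@le_trans _ _ (\sum_(r : 'I_(n ^ al) * 'I_(n ^ be)) Z L ^+ L)).
  apply: ler_sum => r _; apply: le_trans (ler_norm _) _.
  have := @expect_walk R _ _ _ _ (@edge n al be) (@edge_inj n al be) p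
    (n ^ k - j)%N%:R j%:R x y x0 y0 moment _ _ _ _ L.*2 L [::] r r (leqnn _).
  rewrite !card_ord /= mul1r -ZE => h.
  pose M (H : hypergraph n k) := walk (@edge n al be) ((n ^ k - j)%N%:R : R) j%:R H.
  rewrite (@eq_expect _ _ p _ (fun H : hypergraph n k => (\prod_(g <- [::])
    weight (n ^ k - j)%N%:R j%:R H (Some g)) * mpow (M H) L r r)); last first.
    by move=> H; rewrite big_nil mul1r.
  apply: h.
  + by apply: xle; rewrite -[n]expn1 pow_le_sq.
  + by apply: xle; rewrite pow_le_sq.
  + by apply: xle; rewrite pow_le_sq.
  + have -> : (n * n ^ al * n ^ be = n ^ k)%N by rewrite /k expnD expn1 expnD mulnA.
    by rewrite -xsq [(x * sq) ^+ 2]exprMn sqE.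
by rewrite sumr_const card_prod !card_ord -expnD mulr_natl.
Qed.

(** Each of the [L] powers has a factor [2 ^+ k] to spare, so failure has probability at most
    [n^(k-1) 2^(- k L)], and [n <= 2 ^ L] makes this at most [1 / n]. *)
Lemma success_bound l s : let L := (2 ^ l.+1)%N in
  (n <= 2 ^ L)%N -> 0 < ((j * (s - k) ^ k) ^ 2)%:R :> R ->
  Z L * (k`! ^ 2 * s ^ k)%:R * 2 ^+ k <= ((j * (s - k) ^ k) ^ 2)%:R ->
  1 - n%:R^-1 <= hypergraph_prob p (fun H : hypergraph n k => good j R H l s).
Proof.
move=> L nL; have := failure_bound l s; rewrite -/L.
set P := hypergraph_prob _ _; set K := (k`! ^ 2 * s ^ k)%:R; set S := _%:R.
move=> fail S0 ZS.
have P1 : 0 <= 1 - P by rewrite subr_ge0 hypergraph_prob_le1.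
have /andP[p0 p1] := p01.
have Z0 : 0 <= Z L.
  by rewrite /Z !mulr_ge0 ?sqr_ge0 // ltW.
have ZK0 : 0 <= Z L * K by rewrite mulr_ge0.
have SL : 0 < S ^+ L by rewrite exprn_gt0.
have step : S ^+ L * ((1 - P) * (n ^ k)%:R) <= S ^+ L * (n ^ k.-1)%:R.
  apply: (@le_trans _ _ (S ^+ L * (1 - P) * (2 ^+ k) ^+ L)).
    rewrite mulrA; apply: ler_wpM2l; first by rewrite mulr_ge0 ?exprn_ge0 // ltW.
    by rewrite -natrX -natrX ler_nat -expnM mulnC expnM leq_exp2r // ltnW.
  apply: (@le_trans _ _ ((n ^ k.-1)%:R * (Z L * K) ^+ L * (2 ^+ k) ^+ L)).
    by rewrite ler_wpM2r ?exprn_ge0.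
  rewrite -mulrA -exprMn [leRHS]mulrC; apply: ler_wpM2l => //.
  by rewrite lerXn2r ?nnegrE ?mulr_ge0 ?exprn_ge0 // ltW.
rewrite ler_pM2l // in step.
have nR0 : 0 < n%:R :> R by rewrite ltr0n.
have nk0 : 0 < (n ^ k.-1)%:R :> R by rewrite ltr0n expn_gt0 n0.
have ek : (n ^ k = n * n ^ k.-1)%N by rewrite -expnS prednK // ltnW.
rewrite ek natrM mulrA -[leRHS]mul1r ler_pM2r // in step.
have : 1 - P <= n%:R^-1 by rewrite -[_^-1]mul1r ler_pdivlMr.
lra.
Qed.

(** Based on [j >= p W / 2], [s - k >= s / 2] and [s^k t^k >= n^k]. In [8 * 8 ^+ k] the first 8 is
    the 2 in [Z] times the square of the 2 below [p W]; then [(s - k)^k] squared costs [4 ^+ k], and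
    the factor to spare is [2 ^+ k]. *)
Lemma success_parameters l s t (lam : R) : let L := (2 ^ l.+1)%N in
  (0 < t)%N -> (n <= s * t)%N -> (k.*2 <= s)%N -> 1 <= lam ->
  8 * 8 ^+ k * (k`! ^ 2)%:R * (L.*2%:R + 2) ^+ 2 <= lam ^+ 3 ->
  t%:R ^+ (2 * k) * lam ^+ 3 <= p * sq ->
  0 < ((j * (s - k) ^ k) ^ 2)%:R :> R /\
  Z L * (k`! ^ 2 * s ^ k)%:R * 2 ^+ k <= ((j * (s - k) ^ k) ^ 2)%:R.
Proof.
move=> L t0 nst ks lam1; rewrite /Z; set a := L.*2%:R + 2; set f := (k`! ^ 2)%:R.
move=> hlam hp; have /andP[p0 p1] := p01; have /andP[j1 j2] := jp.
have lam3 : 1 <= lam ^+ 3 by rewrite exprn_ege1.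
have f1 : 1 <= f by rewrite ler1n expn_gt0 fact_gt0.
have a2 : 2 <= a by rewrite /a lerDr.
have T1 : 1 <= t%:R ^+ k :> R by rewrite exprn_ege1 // ler1n.
have e81 : 1 <= 8 ^+ k :> R by rewrite exprn_ege1 // ler1n.
set T := t%:R ^+ k in T1; set S := (s%:R : R) ^+ k.
have S0 : 0 <= S by rewrite exprn_ge0.
set G := 8 * 8 ^+ k * f * a ^+ 2 in hlam.
have hpT : T ^+ 2 * lam ^+ 3 <= p * sq by rewrite -exprM mulnC.
have G2 : 2 <= G.
  have h1 : 1 <= 8 ^+ k * f by rewrite mulr_ege1.
  have h2 : 4 <= a ^+ 2 by rewrite expr2; nra.
  by rewrite /G -[8 * _ * f]mulrA; nra.
have psq : lam ^+ 3 <= p * sq.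
  apply: le_trans hpT; apply: ler_peMl; last exact: exprn_ege1.
  exact: le_trans ler01 lam3.
have pW : p * W = p * sq * sq by rewrite -sqE expr2 mulrA.
have pW2 : 2 <= p * W.
  by rewrite pW -[leLHS]mulr1 ler_pM //; lra.
have jW : p * W / 2 <= j%:R by lra.
have ST : sq ^+ 2 <= S * T.
  by rewrite sqE /W /S /T -exprMn -natrM -natrX ler_nat leq_exp2r // ltnW.
(* Cancel [T] in [sq lam^3 T <= sq T^2 lam^3 <= p sq^2 <= p S T]. *)
have pS : sq * G <= p * S.
  have T0 : 0 < T by lra.
  have lamG : sq * G <= sq * lam ^+ 3 by rewrite ler_wpM2l // ltW.
  apply: le_trans lamG _; rewrite -(ler_pM2r T0).
  apply: (@le_trans _ _ (p * sq ^+ 2)); last by rewrite -mulrA ler_wpM2l.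
  apply: (@le_trans _ _ (sq * (T ^+ 2 * lam ^+ 3))).
    rewrite -mulrA ler_wpM2l ?(ltW sq0) // mulrC ler_wpM2r ?(le_trans ler01 lam3) //.
    by rewrite expr2 ler_peMl // ltW.
  have -> : p * sq ^+ 2 = sq * (p * sq) by ring.
  by rewrite ler_wpM2l // ltW.
have pS0 : 0 <= p * S by rewrite mulr_ge0.
have half : s%:R / 2 <= (s - k)%N%:R :> R.
  have ks' : (k <= s)%N by apply: leq_trans ks; rewrite -addnn leq_addr.
  rewrite natrB //; have : k.*2%:R <= s%:R :> R by rewrite ler_nat.
  by rewrite -muln2 natrM; lra.
have sk : S / 2 ^+ k <= ((s - k) ^ k)%:R :> R.
  by rewrite natrX /S -expr_div_n lerXn2r ?nnegrE ?divr_ge0.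
have low : p * W / 2 * (S / 2 ^+ k) <= (j * (s - k) ^ k)%:R.
  by rewrite natrM ler_pM // ?divr_ge0 // ?mulr_ge0 // exprn_ge0.
have G0 : 0 < sq * G by rewrite mulr_gt0 //; lra.
have pos : 0 < p * W / 2 * (S / 2 ^+ k).
  have pSpos : 0 < p * S by lra.
  have Spos : 0 < S.
    by rewrite lt_neqAle S0 andbT eq_sym; apply/eqP => z; move: pSpos; rewrite z mulr0 ltxx.
  have pW0 : 0 < p * W by apply: lt_le_trans pW2.
  by apply: mulr_gt0; apply: divr_gt0 => //; exact: exprn_gt0.
rewrite natrX; split; first by rewrite exprn_gt0 // (lt_le_trans pos).
apply: (@le_trans _ _ ((p * W / 2 * (S / 2 ^+ k)) ^+ 2)); last first.
  by rewrite lerXn2r ?nnegrE // (le_trans (ltW pos)).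
have e8 : 8 ^+ k = 2 ^+ k * (2 ^+ k * 2 ^+ k) :> R.
  by rewrite -!exprMn; congr (_ ^+ _); ring.
have d0 : 0 < 2 ^+ k :> R by rewrite exprn_gt0.
have -> : (k`! ^ 2 * s ^ k)%:R = f * S by rewrite natrM /S -natrX.
set d := 2 ^+ k in e8 d0 *.
have -> : (p * W / 2 * (S / d)) ^+ 2 =
    W ^+ 2 * (p * S) / (4 * d * d) * (p * S) by field; lra.
have -> : W ^+ 2 * (2 * p * sq) * a ^+ 2 * (f * S) * d =
    W ^+ 2 * (p * S) / (4 * d * d) * (sq * G) by rewrite /G e8; field; lra.
by rewrite ler_wpM2l // divr_ge0 ?mulr_ge0 ?sqr_ge0 // ltW.
Qed.

End Completeness.

Lemma bin_le_exp n k : ('C(n, k) <= n ^ k)%N.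
Proof.
apply: (@leq_trans (n ^_ k)).
  by rewrite -bin_ffact leq_pmulr // fact_gt0.
elim: k => [|k IH] //; rewrite ffactnSr expnSr leq_mul //; exact: leq_subr.
Qed.

Lemma hypergraph_prob_mono (R : realType) n k (p : R) (E E' : pred (hypergraph n k)) :
  0 <= p <= 1 -> (forall H, E H -> E' H) -> hypergraph_prob p E <= hypergraph_prob p E'.
Proof.
move=> /andP[p0 p1] EE; rewrite /hypergraph_prob [leLHS]big_mkcond [leRHS]big_mkcond.
apply: ler_sum => H _.
have pmf0 : 0 <= hypergraph_pmf p H.
  by apply: prodr_ge0 => e _; case: ifP => _ //; rewrite subr_ge0.
by case: ifP => [/EE -> //|_]; case: ifP.
Qed.

(** Gives [L <= n] out of [L <= 4 a] and [2 ^ a.-1 < n]. *)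
Lemma mul4_le_exp2 a : (6 <= a)%N -> (4 * a <= 2 ^ a.-1)%N.
Proof.
elim: a => // a IH; rewrite leq_eqVlt => /orP[/eqP <- //|]; rewrite ltnS => a6.
have := IH a6; case: a a6 {IH} => // a a6 /=; rewrite expnS.
lia.
Qed.

Lemma double_add2_le L a : (L <= 4 * a)%N -> (0 < a)%N -> (L.*2 + 2 <= 10 * a)%N.
Proof. lia. Qed.

(** From [n^4 <= s^4 t^4 <= s^4 n] one gets [s >= n^(3/4)], while [m <= n^(1/2)]. The case of
    interest is [m = 2 k]. *)
Lemma four_pow_bound n t s m : (0 < n)%N -> (m ^ 2 <= n)%N -> (t ^ 4 <= n)%N ->
  (n <= s * t)%N -> (m <= s)%N.
Proof.
move=> n0 mn tn nst; rewrite leqNgt; apply/negP => sm.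
have h1 : (n ^ 4 <= s ^ 4 * n)%N.
  by apply: (@leq_trans ((s * t) ^ 4)); rewrite ?leq_exp2r // expnMn leq_mul2l tn orbT.
have h2 : (s ^ 4 < n ^ 2)%N.
  apply: (@leq_trans (m ^ 4)); first by rewrite ltn_exp2r.
  by rewrite (expnM m 2 2) leq_exp2r.
have h3 : (n ^ 3 <= s ^ 4)%N by rewrite -(leq_pmul2r n0) -expnSr.
have h4 : (n ^ 3 < n ^ 2)%N by exact: leq_ltn_trans h3 h2.
by move: h4; rewrite ltnNge leq_pexp2l.
Qed.

(** * The certifying algorithm and its guarantees *)

Section Main.
Variables (R : realType) (al be : nat).
Let k := (1 + (al + be))%N.
Hypothesis al_le : (al.*2 <= k)%N.
Hypothesis be_le : (be.*2 <= k)%N.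
Hypothesis k_gt1 : (1 < k)%N.

Definition certify (x : instance k) : bool :=
  eval_expr (encode x) (k`! ^ 2 + 2) (4 * k).+1 (EMain al be) != 0%N.

Lemma certify_sound n (H : hypergraph n k) (xi : R) :
  certify (Instance H (Num.truncn xi)) -> xi < (chromatic_number H)%:R.
Proof.
move=> /(certify_spec R) spec; have [chi_col _] := chromatic_numberP H k_gt1.
apply: lt_le_trans (truncnS_gt xi) _; rewrite ler_nat.
case: spec => [[-> n0]|[l [j [s [_ jn _ st g]]]]]; last exact: good_not_colorable g st chi_col.
(* The trivial certificate: a vertex rules out a coloring with 0 colors. *)
rewrite lt0n; apply/eqP => chi0; move: chi_col; rewrite chi0 => /existsP[f _].
by case: (f (Ordinal n0)).
Qed.

(** [kappa] turns binary logarithms into natural ones; [C2] collects the constants in front of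
    [ln n] squared, with 10 from [double_add2_le]. *)
Let kappa : R := (ln 2)^-1.
Let C2 : R := 8 * 8 ^+ k * (k`! ^ 2)%:R * (10 * (1 + kappa)) ^+ 2.

Lemma certify_complete n (p xi : R) : 0 <= p <= 1 ->
  (33 <= n)%N -> (k.*2 ^ 2 <= n)%N -> 1 <= ln n%:R :> R -> C2 <= ln n%:R ->
  xi <= n%:R `^ (1 / 4) / ln n%:R ->
  xi ^+ (2 * k) * n%:R `^ (k%:R / 2) * ln n%:R ^+ 3 <= p * ('C(n, k))%:R ->
  1 - n%:R^-1 <=
    hypergraph_prob p (fun H : hypergraph n k => certify (Instance H (Num.truncn xi))).
Proof.
move=> p01 n33 kn lam1 lamC hxi hm; have /andP[p0 p1] := p01.
have n0 : (0 < n)%N by exact: leq_trans n33.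
have nR0 : 0 < n%:R :> R by rewrite ltr0n.
set lam := ln n%:R in lam1 lamC hxi hm.
set t := Num.truncn xi.
have [t0|t0] := posnP t.
  apply: (@le_trans _ _ 1); first by rewrite gerBl invr_ge0.
  rewrite -(hypergraph_prob_total n k p); apply: hypergraph_prob_mono => // H _.
  by apply/(certify_spec R); left.
have xi0 : 0 <= xi.
  rewrite leNgt; apply/negP => xi_lt0; move: t0; rewrite /t.
  have : (Num.truncn xi <= 0)%N by rewrite truncn_le_nat (lt_trans xi_lt0).
  by rewrite leqn0 => /eqP ->.
have txi : t%:R <= xi by have /andP[] := truncn_itv xi0.
pose sq : R := n%:R `^ (k%:R / 2).
have sq0 : 0 < sq by rewrite powR_gt0.
have sqE : sq ^+ 2 = (n ^ k)%:R.
  rewrite -powR_mulrn ?powR_ge0 // -powRrM -mulrA mulVf ?mulr1 ?pnatr_eq0 //.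
  by rewrite powR_mulrn ?natrX.
(* The density assumption divided by [n^(k/2)], after [C(n, k) <= n^k]. *)
have hp : t%:R ^+ (2 * k) * lam ^+ 3 <= p * sq.
  rewrite -(ler_pM2r sq0).
  apply: (@le_trans _ _ (p * ('C(n, k))%:R)).
    apply: le_trans hm; rewrite -/sq mulrAC; apply: ler_wpM2r.
      by rewrite exprn_ge0 // (le_trans ler01).
    by rewrite ler_wpM2r ?(ltW sq0) // lerXn2r ?nnegrE.
  by rewrite -mulrA -expr2 sqE ler_wpM2l // ler_nat bin_le_exp.
have X1 : 1 <= 2 * p * sq.
  have : 1 <= t%:R ^+ (2 * k) * lam ^+ 3.
    by rewrite mulr_ege1 // exprn_ege1 // ler1n.
  by rewrite -mulrA; lra.
pose j := Num.truncn (p * (n ^ k)%:R).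
have jp : j%:R <= p * (n ^ k)%:R < j%:R + 1.
  by have := truncn_itv (mulr_ge0 p0 (ler0n R (n ^ k))); rewrite -natr1.
(* This is [n / t] rounded up, the class size that pigeonhole guarantees: [(s - 1) t < n <= s t]. *)
pose s := (n.-1 %/ t).+1.
have st : ((s - 1) * t < n)%N.
  by rewrite /s subn1 /=; apply: leq_ltn_trans (leq_divM _ _) _; rewrite prednK.
have nst : (n <= s * t)%N.
  by rewrite -(prednK n0) /s ltn_ceil.
have sn : (s <= n)%N.
  by rewrite /s -[leqRHS](prednK n0) ltnS leq_div.
have tn : (t ^ 4 <= n)%N.
  rewrite -(ler_nat R) natrX.
  have tr : t%:R <= n%:R `^ (1 / 4) :> R.
    apply: le_trans txi _; apply: le_trans hxi _.
    by rewrite ler_pdivrMr ?(lt_le_trans ltr01) // ler_peMr ?powR_ge0.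
  apply: le_trans (_ : (n%:R `^ (1 / 4)) ^+ 4 <= _).
    by rewrite lerXn2r ?nnegrE ?powR_ge0.
  by rewrite -powR_mulrn ?powR_ge0 // -powRrM mul1r mulVf ?powRr1 ?pnatr_eq0.
have ks := four_pow_bound n0 kn tn nst.
(* Rounding both logarithms up makes [L] a power of two with [a <= L <= 4 a], so that [n <= 2 ^ L]
   and [L = O(log n)]. *)
pose a := up_log 2 n; pose l := up_log 2 a; pose L := (2 ^ l.+1)%N.
have na : (n <= 2 ^ a)%N by exact: up_logP.
(* Since [n] exceeds [32 = 2 ^ 5]. *)
have a6 : (6 <= a)%N.
  rewrite leqNgt; apply/negP => a5; have := leq_trans n33 na.
  by apply/negP; rewrite -ltnNge; apply: (@leq_ltn_trans (2 ^ 5)) => //; rewrite leq_pexp2l.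
have a1 : (1 < a)%N by exact: leq_trans a6.
have n1 : (1 < n)%N by exact: leq_trans n33.
have aL : (a <= L)%N.
  by apply: leq_trans (up_logP a (isT : 1 < 2)%N) _; rewrite leq_pexp2l.
have L4 : (L <= 4 * a)%N.
  have := up_log_gtn (isT : 1 < 2)%N a1; rewrite -/l /L.
  have : (0 < l)%N by rewrite up_log_gt0.
  by case: (l) => // m _ /= h; rewrite !expnS mulnA leq_mul2l ltnW.
have lt_n := up_log_gtn (isT : 1 < 2)%N n1; rewrite -/a in lt_n.
have Ln : (L <= n)%N.
  by apply: leq_trans L4 _; apply: leq_trans (mul4_le_exp2 a6) _; exact: ltnW.
have ln2 : 0 < ln 2 :> R by apply: ln_gt0; rewrite ltr1n.
have kap0 : 0 < kappa by rewrite invr_gt0.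
have alam : a%:R <= (1 + kappa) * lam.
  have : ln (2 ^+ a.-1) <= lam :> R.
    by rewrite ler_ln ?posrE ?exprn_gt0 // -natrX ler_nat ltnW.
  rewrite lnXn // -[ln 2 *+ _]mulr_natr => h.
  have h2 : a.-1%:R <= kappa * lam by rewrite [leRHS]mulrC /kappa ler_pdivlMr // mulrC.
  have -> : a%:R = 1 + a.-1%:R :> R by rewrite -[1]/(1%:R) -natrD add1n prednK // ltnW.
  by rewrite mulrDl mul1r lerD.
(* The walk bound costs [L] squared, hence two factors [lam]; the third one absorbs the constant
   [C2]. *)
have hlam : 8 * 8 ^+ k * (k`! ^ 2)%:R * (L.*2%:R + 2) ^+ 2 <= lam ^+ 3.
  have LL : L.*2%:R + 2 <= 10 * (1 + kappa) * lam.
    apply: (@le_trans _ _ (10 * a%:R)); last by rewrite -mulrA ler_wpM2l.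
    by rewrite -natrD -natrM ler_nat double_add2_le // ltnW.
  apply: (@le_trans _ _ (C2 * lam ^+ 2)); last first.
    by rewrite [leRHS]exprS ler_wpM2r // sqr_ge0.
  rewrite /C2 -[leRHS]mulrA -exprMn ler_wpM2l ?mulr_ge0 ?exprn_ge0 //.
  by rewrite lerXn2r ?nnegrE // ?addr_ge0 // ?(le_trans _ LL) ?addr_ge0.
have [S0 ZS] := success_parameters p01 sqE sq0 jp t0 nst ks lam1 hlam hp.
have nL : (n <= 2 ^ L)%N by apply: leq_trans na _; rewrite leq_pexp2l.
have := success_bound al_le be_le k_gt1 p01 sqE sq0 jp X1 nL S0 ZS.
move/le_trans; apply; apply: hypergraph_prob_mono => // H g.
apply/(certify_spec R); right; exists l, j, s; split=> //.
rewrite -(ler_nat R); have /andP[h _] := jp; apply: le_trans h _.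
by rewrite ler_piMl.
Qed.

End Main.

Unset Implicit Arguments.
Local Open Scope classical_set_scope.
Local Open Scope ring_scope.

Theorem theoremC5 (R : realType) (k : nat) (hk : (2 <= k)%N) :
  exists (C : R) (certify : instance k -> bool),
    [/\ 0 < C,
        polytime (@encode k) certify,
        (forall (n : nat) (H : hypergraph n k) (xi : R),
            certify (Instance H (Num.truncn xi)) ->
            xi < (chromatic_number H)%:R)
      & forall (p xi : nat -> R),
          (forall n, 0 <= p n <= 1) ->
          (\forall n \near \oo, xi n <= n%:R `^ (1 / 4) / ln n%:R) ->
          (\forall n \near \oo,
             C * (xi n ^+ (2 * k) * n%:R `^ (k%:R / 2) * ln n%:R ^+ 3)
               <= p n * ('C(n, k))%:R) ->
          (fun n => hypergraph_prob (p n)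
             (fun H : hypergraph n k => certify (Instance H (Num.truncn (xi n)))))
            @ \oo --> (1 : R)].
Proof.
have [al [be [ek [al_le be_le]]]] : exists al be, k = (1 + (al + be))%N /\
    (al.*2 <= k /\ be.*2 <= k)%N.
  (* The two halves of [k - 1] differ by at most 1, so neither exceeds [k / 2]. *)
  exists k.-1./2, (k.-1 - k.-1./2)%N; lia.
(* The constant 1 is enough, as for large [n] one factor [ln n] exceeds every constant depending on
   [k]. *)
subst k; exists 1, (@certify al be); split=> //.
- apply: polytime_eval => [|x]; first by rewrite addn2.
  exact: encode_size.
- by move=> n H xi; exact: certify_sound.
move=> p xi p01 hxi hm; set k := (1 + (al + be))%N.
have lnge (c : R) : \forall n \near \oo, c <= ln n%:R.
  near=> n; rewrite -[c]expRK ler_ln ?posrE ?expR_gt0 //.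
    by near: n; exact: nbhs_infty_ger.
  by rewrite ltr0n; near: n; exact: nbhs_infty_gt.
apply: (@squeeze_cvgr _ _ _ _ (fun n => 1 - n%:R^-1) (fun=> 1)).
- near=> n; apply/andP; split; last exact: hypergraph_prob_le1.
  apply: certify_complete => //.
  + by near: n; exact: nbhs_infty_ge.
  + by near: n; exact: nbhs_infty_ge.
  + by near: n; exact: lnge.
  + by near: n; exact: lnge.
  + by near: n; exact: hxi.
  + by rewrite -[leLHS]mul1r; near: n; exact: hm.
- rewrite -[X in _ --> X]subr0; apply: cvgB; first exact: cvg_cst.
  apply/gtr0_cvgV0; last exact: cvgr_idn.
  by near=> n; rewrite ltr0n; near: n; exact: nbhs_infty_gt.
- exact: cvg_cst.
Unshelve. all: by end_near.
Qed.
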